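(* Let $n,r$ be positive integers, $\mathfrak g\in\{\mathfrak{so}_{2n},\mathfrak{sp}_{2n}\}$, $\varrho=q^{2n-1}$ if $\mathfrak g=\mathfrak{so}_{2n}$ and $\varrho=-q^{2n+1}$ if $\mathfrak g=\mathfrak{sp}_{2n}$, and let $V$ be the natural representation of $\mathbf U_\kappa(\mathfrak g)$. Then $V^{\otimes r}\cong(V^{\otimes r})^\circ$ as $(\mathbf U_\kappa(\mathfrak g),\mathcal B_r(\varrho,q))$-bimodules, where $(V^{\otimes r})^\circ$ is the linear dual of $V^{\otimes r}$ with actions $(u\phi)(x)=\phi(\tau(u)x)$ for $u\in\mathbf U_\kappa(\mathfrak g)$ and $(\phi b)(x)=\phi(x\sigma(b))$ for $b\in\mathcal B_r(\varrho,q)$; here $\tau$ is the anti-automorphism of $\mathbf U_\kappa(\mathfrak g)$ with $\tau(k_i)=k_i$, $\tau(e_i)=f_i$, $\tau(f_i)=e_i$ $(1\le i\le n)$, and $\sigma$ is the $\kappa$-linear anti-involution of $\mathcal B_r(\varrho,q)$ fixing all $T_i$ and $E_i$.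
   Context: **Quantum groups.** Let $\epsilon_1,\dots,\epsilon_n$ be orthonormal for $(\ ,\ )$, $\alpha_i=\epsilon_i-\epsilon_{i+1}$ $(i<n)$, $\alpha_n=2\epsilon_n$ for $\mathfrak{sp}_{2n}$ and $\alpha_n=\epsilon_{n-1}+\epsilon_n$ for $\mathfrak{so}_{2n}$; $a_{ij}=2(\alpha_i,\alpha_j)/(\alpha_i,\alpha_i)$; $d_i=1$ for all $i$, except $d_n=2$ for $\mathfrak{sp}_{2n}$. Let $v$ be an indeterminate, $[m]^!_d=\prod_{i=1}^m\frac{v^{di}-v^{-di}}{v^d-v^{-d}}$. $U_v(\mathfrak g)$ is the $\mathbb Q(v)$-algebra generated by $e_i,f_i,k_i^{\pm1}$ $(1\le i\le n)$ with relations: the $k_i^{\pm 1}$ commute, $k_ik_i^{-1}=1$, $k_ie_jk_i^{-1}=v^{d_ia_{ij}}e_j$, $k_if_jk_i^{-1}=v^{-d_ia_{ij}}f_j$, $e_if_j-f_je_i=\delta_{ij}\frac{k_i-k_i^{-1}}{v^{d_i}-v^{-d_i}}$, and the usual quantum Serre relations. Comultiplication: $\Delta(e_i)=e_i\otimes1+k_i\otimes e_i$, $\Delta(f_i)=f_i\otimes k_i^{-1}+1\otimes f_i$, $\Delta(k_i)=k_i\otimes k_i$. With $\mathcal A=\mathbb Z[v,v^{-1}]$, $\mathbf U(\mathfrak g)$ is the $\mathcal A$-subalgebra generated by the divided powers $e_i^{(k)}=e_i^k/[k]^!_{d_i}$, $f_i^{(k)}=f_i^k/[k]^!_{d_i}$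 and $k_i^{\pm1}$. $\kappa$ is a field containing nonzero $q$ with $q^2\ne1$, an $\mathcal A$-algebra via $v\mapsto q$; $\mathbf U_\kappa(\mathfrak g)=\mathbf U(\mathfrak g)\otimes_{\mathcal A}\kappa$. (The anti-automorphism $\tau$ is induced from $U_v(\mathfrak g)$, so it interchanges $e_i^{(k)}$ and $f_i^{(k)}$.) **Natural representation.** $V=\bigoplus_{i=1}^{2n}\kappa v_i$, $i'=2n+1-i$. For $i<n$: $e_iv_{i+1}=v_i$, $e_iv_{i'}=-v_{(i+1)'}$; $f_iv_i=v_{i+1}$, $f_iv_{(i+1)'}=-v_{i'}$; $k_iv_k=qv_k$ for $k\in\{i,(i+1)'\}$, $k_iv_k=q^{-1}v_k$ for $k\in\{i+1,i'\}$. For $\mathfrak{sp}_{2n}$: $e_nv_{n'}=v_n$, $f_nv_n=v_{n'}$, $k_nv_n=q^2v_n$, $k_nv_{n'}=q^{-2}v_{n'}$. For $\mathfrak{so}_{2n}$: $e_nv_{n'}=v_{n-1}$, $e_nv_{(n-1)'}=-v_n$, $f_nv_{n-1}=v_{n'}$, $f_nv_n=-v_{(n-1)'}$, $k_nv_k=qv_k$ for $k\in\{n-1,n\}$, $k_nv_k=q^{-1}v_k$ for $k\in\{n',(n-1)'\}$. In all unlisted cases $e_i,f_i$ act by $0$ and $k_i$ by $1$; divided powers with $k\ge2$ act by $0$ on $V$. **BMW algebra.** $\mathcal B_r(\varrho,q)$ is the unital associative $\kappa$-algebra generated by $T_i,E_i$ $(1\le i\le r-1)$ with relations $(T_i-q)(T_i+q^{-1})(T_i-\varrho^{-1})=0$;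 $T_iT_{i+1}T_i=T_{i+1}T_iT_{i+1}$; $T_iT_j=T_jT_i$ for $|i-j|>1$; $E_iT_j^{\pm1}E_i=\varrho^{\pm1}E_i$ for $j=i\pm1$; $E_iT_i=T_iE_i=\varrho^{-1}E_i$; where $T_i-T_i^{-1}=(q-q^{-1})(1-E_i)$. **Right action on $V^{\otimes r}$.** $T_i$ and $E_i$ act as $\breve R$ and $E$ on tensor factors $i,i+1$. Let $\rho=(\rho_1,\dots,\rho_{2n})$ be $(n-1,\dots,1,0,0,-1,\dots,1-n)$ for $\mathfrak{so}_{2n}$ and $(n,\dots,1,-1,\dots,-n)$ for $\mathfrak{sp}_{2n}$; $\varepsilon_i=1$, except $\varepsilon_i=-1$ when $\mathfrak g=\mathfrak{sp}_{2n}$ and $i\ge n+1$; $\delta=q-q^{-1}$. $(v_k\otimes v_\ell)\breve R$ equals: $qv_k\otimes v_k$ if $k=\ell$; $v_\ell\otimes v_k$ if $k>\ell$, $k\ne\ell'$; $q^{-1}v_\ell\otimes v_k-\delta\sum_{i>k}q^{\rho_i-\rho_k}\varepsilon_i\varepsilon_kv_{i'}\otimes v_i$ if $k>\ell$, $k=\ell'$; $v_\ell\otimes v_k+\delta v_k\otimes v_\ell$ if $k<\ell$, $k\neq\ell'$; $q^{-1}v_\ell\otimes v_k+\delta\big(v_k\otimes v_\ell-\sum_{i>k}q^{\rho_i-\rho_k}\varepsilon_i\varepsilon_kv_{i'}\otimes v_i\big)$ if $k<\ell$, $k=\ell'$. Also $(v_k\otimes v_\ell)E=\sum_{i=1}^{2n}q^{\rho_{i'}-\rho_k}\varepsilon_{i'}\varepsilon_kv_i\otimes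 v_{i'}$ if $k=\ell'$ and $0$ otherwise. *)

(* Defs.v *)
From HB Require Import structures.
From mathcomp Require Import all_boot all_order all_algebra.
From mathcomp Require Import boolp.

Set Implicit Arguments.
Unset Strict Implicit.
Unset Printing Implicit Defensive.

Import GRing.Theory.
Local Open Scope ring_scope.
Local Open Scope quotient_scope.

(* All algebras below are associative, unital and given by generators G and
   relations rel: formal expressions modulo the least congruence containing rel
   for which the quotient is an R-algebra. As 1 != 0 cannot be guaranteed, the
   quotient is a pzRingType and an lmodType, but not an algType. *)

Inductive expr (R G : Type) : Type :=
| Gen of G
| Cst of R
| Add of expr R G & expr R G
| Mul of expr R G & expr R G.

Arguments Gen {R G}.
Arguments Cst {R G}.
Arguments Add {R G}.
Arguments Mul {R G}.

HB.instance Definition _ (R G : Type) := gen_eqMixin (expr R G).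
HB.instance Definition _ (R G : Type) := gen_choiceMixin (expr R G).

Declare Scope expr_scope.
Delimit Scope expr_scope with E.
Bind Scope expr_scope with expr.
Notation "x + y" := (Add x y) : expr_scope.
Notation "x * y" := (Mul x y) : expr_scope.
Notation "a *: x" := (Mul (Cst a%R) x) : expr_scope.
Notation "x - y" := (Add x (Mul (Cst (-1)%R) y)) : expr_scope.
Notation "x ^+ m" := (iter m (Mul x) (Cst 1%R)) : expr_scope.

Record palg (R : comNzRingType) := Palg {
  gens : Type;
  rels : expr R gens -> expr R gens -> Prop
}.

Section Presentation.
Variables (R : comNzRingType) (A : palg R).
Local Notation tm := (expr R (gens A)).

Inductive cong : tm -> tm -> Prop :=
| cong_refl x : cong x x
| cong_sym x y : cong x y -> cong y x
| cong_trans x y z : cong x y -> cong y z -> cong x z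
| cong_add x x' y y' :
    cong x x' -> cong y y' -> cong (x + y)%E (x' + y')%E
| cong_mul x x' y y' :
    cong x x' -> cong y y' -> cong (x * y)%E (x' * y')%E
| cong_addA x y z : cong (x + (y + z))%E (x + y + z)%E
| cong_addC x y : cong (x + y)%E (y + x)%E
| cong_add0 x : cong (Cst 0 + x)%E x
| cong_addN x : cong (-1 *: x + x)%E (Cst 0)
| cong_mulA x y z : cong (x * (y * z))%E (x * y * z)%E
| cong_mul1l x : cong (Cst 1 * x)%E x
| cong_mul1r x : cong (x * Cst 1)%E x
| cong_mulDl x y z : cong ((x + y) * z)%E (x * z + y * z)%E
| cong_mulDr x y z : cong (x * (y + z))%E (x * y + x * z)%E
| cong_cstD a b : cong (Cst (a + b)) (Cst a + Cst b)%E
| cong_cstM a b : cong (Cst (a * b)) (Cst a * Cst b)%E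
| cong_cstC a x : cong (Cst a * x)%E (x * Cst a)%E
| cong_rel x y : rels x y -> cong x y.

Definition congb (x y : tm) : bool := `[< cong x y >].

Lemma congb_refl : reflexive congb.
Proof. by move=> x; apply/asboolP; exact: cong_refl. Qed.

Lemma congb_sym : symmetric congb.
Proof.
by move=> x y; apply/asboolP/asboolP; exact: cong_sym.
Qed.

Lemma congb_trans : transitive congb.
Proof.
move=> y x z /asboolP xy /asboolP yz; apply/asboolP.
exact: cong_trans xy yz.
Qed.

Canonical congb_equiv := EquivRel congb congb_refl congb_sym congb_trans.

Definition presented := {eq_quot congb}.

HB.instance Definition _ := EqQuotient.on presented.
HB.instance Definition _ := Choice.on presented.

Definition cls (x : tm) : presented := \pi x.

Lemma clsP (x y : tm) : cls x = cls y <-> cong x y.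
Proof.
split=> [/eqmodP /asboolP //|xy].
by apply/eqmodP/asboolP.
Qed.

Lemma cls_repr (x : presented) : cls (repr x) = x.
Proof. exact: reprK. Qed.

Definition padd (x y : presented) := cls (repr x + repr y)%E.
Definition pmul (x y : presented) := cls (repr x * repr y)%E.
Definition pscale (a : R) (x : presented) := cls (a *: repr x)%E.

Lemma repr_cls (x : tm) : cong (repr (cls x)) x.
Proof. by apply/clsP; rewrite cls_repr. Qed.

Lemma cls_add (x y : tm) : padd (cls x) (cls y) = cls (x + y)%E.
Proof. by apply/clsP; apply: cong_add; exact: repr_cls. Qed.

Lemma cls_mul (x y : tm) : pmul (cls x) (cls y) = cls (x * y)%E.
Proof. by apply/clsP; apply: cong_mul; exact: repr_cls. Qed.

Lemma cls_scale (a : R) (x : tm) : pscale a (cls x) = cls (a *: x)%E.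
Proof. by apply/clsP; apply: cong_mul; [exact: cong_refl|exact: repr_cls]. Qed.

Lemma cls_ind (P : presented -> Prop) : (forall x, P (cls x)) -> forall x, P x.
Proof. by move=> H x; rewrite -(cls_repr x). Qed.

Lemma paddA : associative padd.
Proof.
elim/cls_ind=> x; elim/cls_ind=> y; elim/cls_ind=> z.
by rewrite !cls_add; apply/clsP; exact: cong_addA.
Qed.

Lemma paddC : commutative padd.
Proof.
elim/cls_ind=> x; elim/cls_ind=> y.
by rewrite !cls_add; apply/clsP; exact: cong_addC.
Qed.

Lemma padd0 : left_id (cls (Cst 0)) padd.
Proof.
by elim/cls_ind=> x; rewrite cls_add; apply/clsP; exact: cong_add0.
Qed.

Lemma paddN : left_inverse (cls (Cst 0)) (pscale (-1)) padd.
Proof.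
elim/cls_ind=> x; rewrite cls_scale cls_add; apply/clsP; exact: cong_addN.
Qed.

HB.instance Definition _ :=
  GRing.isZmodule.Build presented paddA paddC padd0 paddN.

Lemma pmulA : associative pmul.
Proof.
elim/cls_ind=> x; elim/cls_ind=> y; elim/cls_ind=> z.
by rewrite !cls_mul; apply/clsP; exact: cong_mulA.
Qed.

Lemma pmul1l : left_id (cls (Cst 1)) pmul.
Proof. by elim/cls_ind=> x; rewrite cls_mul; apply/clsP; exact: cong_mul1l. Qed.

Lemma pmul1r : right_id (cls (Cst 1)) pmul.
Proof. by elim/cls_ind=> x; rewrite cls_mul; apply/clsP; exact: cong_mul1r. Qed.

Lemma pmulDl : left_distributive pmul padd.
Proof.
elim/cls_ind=> x; elim/cls_ind=> y; elim/cls_ind=> z.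
by rewrite cls_add !cls_mul cls_add; apply/clsP; exact: cong_mulDl.
Qed.

Lemma pmulDr : right_distributive pmul padd.
Proof.
elim/cls_ind=> x; elim/cls_ind=> y; elim/cls_ind=> z.
by rewrite cls_add !cls_mul cls_add; apply/clsP; exact: cong_mulDr.
Qed.

HB.instance Definition _ :=
  GRing.Zmodule_isPzRing.Build presented pmulA pmul1l pmul1r pmulDl pmulDr.

Lemma pscaleA a b (x : presented) : pscale a (pscale b x) = pscale (a * b) x.
Proof.
elim/cls_ind: x => x; rewrite !cls_scale; apply/clsP.
apply: cong_trans (cong_mulA _ _ _) _.
by apply: cong_mul; [apply: cong_sym; exact: cong_cstM|exact: cong_refl].
Qed.

Lemma pscale1 : left_id 1 pscale.
Proof. by elim/cls_ind=> x; rewrite cls_scale; apply/clsP; exact: cong_mul1l. Qed.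

Lemma pscaleDr : right_distributive pscale +%R.
Proof.
move=> a; elim/cls_ind=> x; elim/cls_ind=> y.
change (pscale a (padd (cls x) (cls y)) =
  padd (pscale a (cls x)) (pscale a (cls y))).
by rewrite cls_add !cls_scale cls_add; apply/clsP; exact: cong_mulDr.
Qed.

Lemma pscaleDl (x : presented) : {morph pscale^~ x : a b / a + b}.
Proof.
elim/cls_ind: x => x a b.
change (pscale (a + b) (cls x) = padd (pscale a (cls x)) (pscale b (cls x))).
rewrite !cls_scale cls_add.
apply/clsP; apply: cong_trans (cong_mulDl _ _ _).
by apply: cong_mul; [exact: cong_cstD|exact: cong_refl].
Qed.

HB.instance Definition _ := GRing.Zmodule_isLmodule.Build R presented
  pscaleA pscale1 pscaleDr pscaleDl.

Lemma presented_scalerAl (a : R) (x y : presented) :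
  a *: (x * y) = (a *: x) * y.
Proof.
elim/cls_ind: x => x; elim/cls_ind: y => y.
change (pscale a (pmul (cls x) (cls y)) = pmul (pscale a (cls x)) (cls y)).
by rewrite cls_mul !cls_scale cls_mul; apply/clsP; exact: cong_mulA.
Qed.

Lemma presented_scalerAr (a : R) (x y : presented) :
  a *: (x * y) = x * (a *: y).
Proof.
elim/cls_ind: x => x; elim/cls_ind: y => y.
change (pscale a (pmul (cls x) (cls y)) = pmul (cls x) (pscale a (cls y))).
rewrite cls_mul !cls_scale cls_mul; apply/clsP.
apply: cong_trans (cong_mulA _ _ _) _.
apply: cong_trans (cong_mul (cong_cstC _ _) (cong_refl _)) _.
exact: cong_sym (cong_mulA _ _ _).
Qed.

Definition gen (x : gens A) : presented := cls (Gen x).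

End Presentation.

Coercion presented : palg >-> Sortclass.

Record algHom (R : comNzRingType) (A B : palg R) := AlgHom {
  hom_fun :> A -> B;
  hom_linear : linear hom_fun;
  hom_monoid : monoid_morphism hom_fun
}.

Record algAntiHom (R : comNzRingType) (A B : palg R) := AlgAntiHom {
  anti_fun :> A -> B;
  anti_linear : linear anti_fun;
  anti_one : anti_fun 1 = 1;
  anti_mul : {morph anti_fun : x y / x * y >-> y * x}
}.

Section Tensor.
Variables (R : comNzRingType) (A B : palg R).

Inductive tens_rel : expr R (A * B) -> expr R (A * B) -> Prop :=
| tens_addl a a' b : tens_rel (Gen (a + a', b)) (Gen (a, b) + Gen (a', b))
| tens_addr a b b' : tens_rel (Gen (a, b + b')) (Gen (a, b) + Gen (a, b'))
| tens_scalel x a b : tens_rel (Gen (x *: a, b)) (x *: Gen (a, b))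
| tens_scaler x a b : tens_rel (Gen (a, x *: b)) (x *: Gen (a, b))
| tens_mul a a' b b' :
    tens_rel (Gen (a, b) * Gen (a', b')) (Gen (a * a', b * b'))
| tens_one : tens_rel (Gen (1, 1)) (Cst 1).

Definition tensor : palg R := Palg tens_rel.

Definition tens (a : A) (b : B) : tensor := gen (A := tensor) (a, b).

End Tensor.

Notation "x ⊗ y" := (tens x y) (at level 40, left associativity).

Record lmodule (K : fieldType) (A : palg K) (W : vectType K) := LModule {
  lact :> A -> 'End(W);
  lact_linear : linear lact;
  lact_one : lact 1 = \1%VF;
  lact_mul : forall a b, lact (a * b) = (lact a \o lact b)%VF
}.

Record rmodule (K : fieldType) (A : palg K) (W : vectType K) := RModule {
  ract :> A -> 'End(W);
  ract_linear : linear ract;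
  ract_one : ract 1 = \1%VF;
  ract_mul : forall a b, ract (a * b) = (ract b \o ract a)%VF
}.

Record bimodule (K : fieldType) (A B : palg K) (W : vectType K) :=
  Bimodule {
  bleft : lmodule A W;
  bright : rmodule B W;
  bleft_right : forall a b,
    (bleft a \o bright b = bright b \o bleft a)%VF
}.

Definition bimodule_iso (K : fieldType) (A B : palg K)
    (W W' : vectType K) (M : bimodule A B W) (M' : bimodule A B W') : Prop :=
  exists phi : 'Hom(W, W'),
    [/\ bijective phi,
        forall a x, phi (bleft M a x) = bleft M' a (phi x) &
        forall b x, phi (bright M b x) = bright M' b (phi x)].

Section Dual.
Variables (K : fieldType) (A B : palg K) (W : vectType K).
Variables (tau : algAntiHom A A) (sigma : algAntiHom B B).
Variable M : bimodule A B W.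

Definition precomp (f : 'End(W)) (phi : 'Hom(W, K^o)) : 'Hom(W, K^o) :=
  (phi \o f)%VF.

Lemma precomp_linear f : linear (precomp f).
Proof. by move=> a x y; rewrite /precomp comp_lfunDl comp_lfunZl. Qed.

HB.instance Definition _ f :=
  GRing.isLinear.Build K 'Hom(W, K^o) 'Hom(W, K^o) _ (precomp f)
    (precomp_linear f).

Definition transpose (f : 'End(W)) : 'End('Hom(W, K^o)) := linfun (precomp f).

Lemma transposeE f phi x : transpose f phi x = phi (f x).
Proof. by rewrite /transpose lfunE comp_lfunE. Qed.

Lemma transpose_linear : linear transpose.
Proof.
move=> a f g; apply/lfunP=> phi; apply/lfunP=> x.
by rewrite !(transposeE, add_lfunE, scale_lfunE, linearD, linearZ).
Qed.

Lemma transpose1 : transpose \1%VF = \1%VF.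
Proof.
by apply/lfunP=> phi; apply/lfunP=> x; rewrite transposeE !id_lfunE.
Qed.

Lemma transpose_comp f g :
  transpose (f \o g)%VF = (transpose g \o transpose f)%VF.
Proof.
by apply/lfunP=> phi; apply/lfunP=> x; rewrite !(transposeE, comp_lfunE).
Qed.

Definition dual_lact (a : A) := transpose (bleft M (tau a)).
Definition dual_ract (b : B) := transpose (bright M (sigma b)).

Lemma dual_lact_linear : linear dual_lact.
Proof.
by move=> x a b; rewrite /dual_lact anti_linear lact_linear transpose_linear.
Qed.

Lemma dual_lact_one : dual_lact 1 = \1%VF.
Proof. by rewrite /dual_lact anti_one lact_one transpose1. Qed.

Lemma dual_lact_mul a b : dual_lact (a * b) = (dual_lact a \o dual_lact b)%VF.
Proof. by rewrite /dual_lact anti_mul lact_mul transpose_comp. Qed.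

Lemma dual_ract_linear : linear dual_ract.
Proof.
by move=> x a b; rewrite /dual_ract anti_linear ract_linear transpose_linear.
Qed.

Lemma dual_ract_one : dual_ract 1 = \1%VF.
Proof. by rewrite /dual_ract anti_one ract_one transpose1. Qed.

Lemma dual_ract_mul a b : dual_ract (a * b) = (dual_ract b \o dual_ract a)%VF.
Proof. by rewrite /dual_ract anti_mul ract_mul transpose_comp. Qed.

Lemma dual_lract a b :
  (dual_lact a \o dual_ract b = dual_ract b \o dual_lact a)%VF.
Proof. by rewrite -!transpose_comp bleft_right. Qed.

Definition dual_bimodule : bimodule A B 'Hom(W, K^o) :=
  @Bimodule K A B _
    (LModule dual_lact_linear dual_lact_one dual_lact_mul)
    (RModule dual_ract_linear dual_ract_one dual_ract_mul)
    dual_lract.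

End Dual.

(* SO stands for so_{2n} and SP for sp_{2n}. Formulas use 1-based labels, the
   generator labelled i.+1 being indexed by i : 'I_n. The root alpha_n of so_{2n}
   is only defined for n >= 2: for SO and n = 1 the formulas read with
   eps 0 = 0 and vb 0 = 0, and no module satisfies is_natural. *)

Variant lie_type := SO | SP.

Section QuantumGroup.
Variables (g : lie_type) (n : nat).

Definition eps (a : nat) : 'rV[int]_n := \row_j (j.+1 == a)%:R.

Definition dot (x y : 'rV[int]_n) : int := \sum_j x 0 j * y 0 j.

Definition alpha (i : nat) : 'rV[int]_n :=
  if (i < n)%N then eps i - eps i.+1
  else match g with
       | SP => eps n *+ 2
       | SO => eps n.-1 + eps n
       end.

Definition cartan (i j : 'I_n) : int :=
  ((2 * dot (alpha i.+1) (alpha j.+1)) %/ dot (alpha i.+1) (alpha i.+1))%Z.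

Definition dd (i : 'I_n) : nat :=
  match g with SP => if i.+1 == n then 2 else 1 | SO => 1 end.

Definition Qv : fieldType := {fraction {poly rat}}.
Definition v : Qv := FracField.tofrac 'X.

Definition qfact (d m : nat) : Qv :=
  \prod_(1 <= i < m.+1) ((v ^+ (d * i) - v ^- (d * i)) / (v ^+ d - v ^- d)).

Definition qbin (d m s : nat) : Qv :=
  qfact d m / (qfact d s * qfact d (m - s)).

Variant qgen := QE of 'I_n | QF of 'I_n | QK of 'I_n | QKV of 'I_n.

Local Notation E i := (Gen (QE i)).
Local Notation F i := (Gen (QF i)).
Local Notation K i := (Gen (QK i)).
Local Notation KV i := (Gen (QKV i)).

Definition serre (x y : expr Qv qgen) (d m : nat) : expr Qv qgen :=
  \big[Add/Cst 0]_(s < m.+1)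
    (((-1) ^+ s * qbin d m s) *: (x ^+ (m - s) * (y * x ^+ s)))%E.

Inductive Uv_rel : expr Qv qgen -> expr Qv qgen -> Prop :=
| Uv_KK i j : Uv_rel (K i * K j) (K j * K i)
| Uv_KKV i j : Uv_rel (K i * KV j) (KV j * K i)
| Uv_KVKV i j : Uv_rel (KV i * KV j) (KV j * KV i)
| Uv_K1 i : Uv_rel (K i * KV i) (Cst 1)
| Uv_KE i j :
    Uv_rel (K i * E j * KV i) (v ^ ((dd i)%:Z * cartan i j) *: E j)
| Uv_KF i j :
    Uv_rel (K i * F j * KV i) (v ^ (- ((dd i)%:Z * cartan i j)) *: F j)
| Uv_EF i j :
    Uv_rel (E i * F j - F j * E i)
      (((i == j)%:R / (v ^+ dd i - v ^- dd i)) *: (K i - KV i))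
| Uv_serreE i j : i != j ->
    Uv_rel (serre (E i) (E j) (dd i) `|1 - cartan i j|) (Cst 0)
| Uv_serreF i j : i != j ->
    Uv_rel (serre (F i) (F j) (dd i) `|1 - cartan i j|) (Cst 0).

Definition Uv : palg Qv := Palg Uv_rel.

Definition ev (i : 'I_n) : Uv := gen (A := Uv) (QE i).
Definition fv (i : 'I_n) : Uv := gen (A := Uv) (QF i).
Definition kv (i : 'I_n) : Uv := gen (A := Uv) (QK i).
Definition kvV (i : 'I_n) : Uv := gen (A := Uv) (QKV i).

Definition divpow (d : nat) (x : Uv) (m : nat) : Uv := (qfact d m)^-1 *: x ^+ m.

(* The element p(v) v^-m of Z[v,v^-1], specialised at v = x. *)
Definition laurent (F : fieldType) (x : F) (p : {poly int}) (m : nat) : F :=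
  (map_poly (fun z : int => z%:~R) p).[x] / x ^+ m.

Inductive inUA : Uv -> Prop :=
| inUA_e i m : inUA (divpow (dd i) (ev i) m)
| inUA_f i m : inUA (divpow (dd i) (fv i) m)
| inUA_k i : inUA (kv i)
| inUA_kV i : inUA (kvV i)
| inUA_one : inUA 1
| inUA_add x y : inUA x -> inUA y -> inUA (x + y)
| inUA_mul x y : inUA x -> inUA y -> inUA (x * y)
| inUA_scale p m x : inUA x -> inUA (laurent v p m *: x).

Definition UA : Type := {x : Uv | inUA x}.

Definition eA (i : 'I_n) (m : nat) : UA := exist inUA _ (inUA_e i m).
Definition fA (i : 'I_n) (m : nat) : UA := exist inUA _ (inUA_f i m).
Definition kA (i : 'I_n) : UA := exist inUA _ (inUA_k i).

(* U(g) (x)_A kappa, A = Z[v,v^-1] acting on kappa by v |-> q: the generator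
   (u, c) is the pure tensor of u and c. *)

Section Specialisation.
Variables (kap : fieldType) (q : kap).

Inductive Uk_rel : expr kap (UA * kap) -> expr kap (UA * kap) -> Prop :=
| Uk_addl (u1 u2 u : UA) c : sval u = sval u1 + sval u2 ->
    Uk_rel (Gen (u, c)) (Gen (u1, c) + Gen (u2, c))
| Uk_addr u c1 c2 : Uk_rel (Gen (u, c1 + c2)) (Gen (u, c1) + Gen (u, c2))
| Uk_balanced (u u' : UA) p m c : sval u' = laurent v p m *: sval u ->
    Uk_rel (Gen (u', c)) (Gen (u, laurent q p m * c))
| Uk_scale u a c : Uk_rel (a *: Gen (u, c)) (Gen (u, a * c))
| Uk_mul (u1 u2 u : UA) c1 c2 : sval u = sval u1 * sval u2 ->
    Uk_rel (Gen (u1, c1) * Gen (u2, c2)) (Gen (u, c1 * c2))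
| Uk_one (u : UA) : sval u = 1 -> Uk_rel (Gen (u, 1)) (Cst 1).

Definition Uk : palg kap := Palg Uk_rel.

Definition spec (u : UA) : Uk := gen (A := Uk) (u, 1).

(* D is induced by the comultiplication Dv of Uv: each decomposition of Dv u,
   u in U(g), into pure tensors over U(g) specialises to one of D (u (x) 1). *)

Definition is_comul_v (D : algHom Uv (tensor Uv Uv)) : Prop :=
  forall i, [/\ D (ev i) = ev i ⊗ 1 + kv i ⊗ ev i,
                D (fv i) = fv i ⊗ kvV i + 1 ⊗ fv i &
                D (kv i) = kv i ⊗ kv i].

Definition is_comul (D : algHom Uk (tensor Uk Uk)) : Prop :=
  exists2 Dv : algHom Uv (tensor Uv Uv), is_comul_v Dv &
    forall (u : UA) (s : seq (UA * UA)),
      Dv (sval u) = \sum_(p <- s) sval p.1 ⊗ sval p.2 ->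
      D (spec u) = \sum_(p <- s) spec p.1 ⊗ spec p.2.

Definition is_tau (tau : algAntiHom Uk Uk) : Prop :=
  bijective tau /\
  forall i, [/\ tau (spec (kA i)) = spec (kA i),
                forall m, tau (spec (eA i m)) = spec (fA i m) &
                forall m, tau (spec (fA i m)) = spec (eA i m)].

(* Tensor powers of V, with basis the v_I, I an r-tuple of indices; index j
   (0-based) of the type 'I_n.*2 stands for the basis vector v_{j+1}, so that
   i |-> i' is rev_ord. *)

Definition Vec : vectType kap := {ffun 'I_n.*2 -> kap^o}.
Definition Tens (r : nat) : vectType kap := {ffun r.-tuple 'I_n.*2 -> kap^o}.

Definition bas (I : finType) (i : I) : {ffun I -> kap^o} :=
  [ffun j => (j == i)%:R].

(* 1-based: vb k = v_k for 1 <= k <= 2n, and vb k = 0 otherwise. *)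
Definition vb (k : nat) : Vec := [ffun j : 'I_n.*2 => (j.+1 == k)%:R].

Definition pr (k : nat) : nat := n.*2.+1 - k.

Definition nat_e (i k : nat) : Vec :=
  if (i < n)%N then
    if k == i.+1 then vb i else if k == pr i then - vb (pr i.+1) else 0
  else match g with
       | SP => if k == pr n then vb n else 0
       | SO => if k == pr n then vb n.-1
               else if k == pr n.-1 then - vb n else 0
       end.

Definition nat_f (i k : nat) : Vec :=
  if (i < n)%N then
    if k == i then vb i.+1 else if k == pr i.+1 then - vb (pr i) else 0
  else match g with
       | SP => if k == n then vb (pr n) else 0
       | SO => if k == n.-1 then vb (pr n)
               else if k == n then - vb (pr n.-1) else 0
       end.

Definition nat_k (i k : nat) : kap :=
  if (i < n)%N then
    if (k == i) || (k == pr i.+1) then q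
    else if (k == i.+1) || (k == pr i) then q^-1 else 1
  else match g with
       | SP => if k == n then q ^+ 2 else if k == pr n then q ^- 2 else 1
       | SO => if (k == n.-1) || (k == n) then q
               else if (k == pr n) || (k == pr n.-1) then q^-1 else 1
       end.

Definition is_natural (V : lmodule Uk Vec) : Prop :=
  forall (i : 'I_n) (k : 'I_n.*2),
    [/\ V (spec (eA i 1)) (bas k) = nat_e i.+1 k.+1,
        V (spec (fA i 1)) (bas k) = nat_f i.+1 k.+1,
        V (spec (kA i)) (bas k) = nat_k i.+1 k.+1 *: bas k,
        forall m, (2 <= m)%N -> V (spec (eA i m)) (bas k) = 0 &
        forall m, (2 <= m)%N -> V (spec (fA i m)) (bas k) = 0].

Definition tens1 (x : Vec) : Tens 1 := [ffun I => x (thead I)].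

Definition tensS (r : nat) (x : Vec) (y : Tens r) : Tens r.+1 :=
  [ffun I => x (thead I) * y [tuple of behead I]].

(* tensor_power D V r W: W is the r-fold tensor power (r >= 1) of the module V,
   with respect to the comultiplication D:
   u (x (x) y) = sum u' x (x) u'' y whenever D u = sum u' (x) u''. *)
Inductive tensor_power (D : algHom Uk (tensor Uk Uk)) (V : lmodule Uk Vec) :
    forall r, lmodule Uk (Tens r) -> Prop :=
| tensor_power1 (W : lmodule Uk (Tens 1)) :
    (forall u x, W u (tens1 x) = tens1 (V u x)) -> tensor_power D V W
| tensor_powerS r (W : lmodule Uk (Tens r)) (W' : lmodule Uk (Tens r.+1)) :
    tensor_power D V W ->
    (forall u (s : seq (Uk * Uk)), D u = \sum_(p <- s) p.1 ⊗ p.2 ->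
       forall x y, W' u (tensS x y) = \sum_(p <- s) tensS (V p.1 x) (W p.2 y)) ->
    tensor_power D V W'.

(* Rop k l and Eop k l are (v_k (x) v_l) R and (v_k (x) v_l) E. *)

Definition rho (i : 'I_n.*2) : int :=
  match g with
  | SO => if (i < n)%N then n%:Z - i.+1%:Z else n%:Z - i%:Z
  | SP => if (i < n)%N then n%:Z - i%:Z else n%:Z - i.+1%:Z
  end.

Definition sgn (i : 'I_n.*2) : kap :=
  match g with SO => 1 | SP => if (i < n)%N then 1 else -1 end.

Definition vv (i j : 'I_n.*2) : {ffun 'I_n.*2 * 'I_n.*2 -> kap^o} :=
  bas (i, j).

Definition Rsum (k : 'I_n.*2) : {ffun 'I_n.*2 * 'I_n.*2 -> kap^o} :=
  \sum_(i : 'I_n.*2 | (k < i)%N)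
    (q ^ (rho i - rho k) * sgn i * sgn k) *: vv (rev_ord i) i.

Definition Rop (k l : 'I_n.*2) : {ffun 'I_n.*2 * 'I_n.*2 -> kap^o} :=
  let delta := q - q^-1 in
  if k == l then q *: vv k k
  else if (l < k)%N then
    if k == rev_ord l then q^-1 *: vv l k - delta *: Rsum k else vv l k
  else
    if k == rev_ord l then q^-1 *: vv l k + delta *: (vv k l - Rsum k)
    else vv l k + delta *: vv k l.

Definition Eop (k l : 'I_n.*2) : {ffun 'I_n.*2 * 'I_n.*2 -> kap^o} :=
  if k == rev_ord l then
    \sum_i (q ^ (rho (rev_ord i) - rho k) * sgn (rev_ord i) * sgn k)
             *: vv i (rev_ord i)
  else 0.

Section Positions.
Variable r : nat.

Lemma next_proof (i : 'I_r.-1) : (i.+1 < r)%N.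
Proof. by rewrite -ltn_predRL. Qed.

Definition pos (i : 'I_r.-1) : 'I_r := widen_ord (leq_pred r) i.
Definition next (i : 'I_r.-1) : 'I_r := Ordinal (next_proof i).

(* Image of v_I under op acting on the tensor factors pos i, next i. *)
Definition act_at (op : 'I_n.*2 -> 'I_n.*2 -> {ffun 'I_n.*2 * 'I_n.*2 -> kap^o})
    (i : 'I_r.-1) (I : r.-tuple 'I_n.*2) : Tens r :=
  \sum_a \sum_b
    (op (tnth I (pos i)) (tnth I (next i)) (a, b) : kap) *:
      bas [tuple if j == pos i then a else if j == next i then b
                 else tnth I j | j < r].

End Positions.

End Specialisation.

End QuantumGroup.

(* T_i^-1 is added as a generator inverse to T_i; the cubic relation already
   makes T_i invertible, so this does not change the algebra. *)

Section BMW.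
Variables (r : nat) (kap : fieldType) (vrho q : kap).

Variant bgen := BT of 'I_r.-1 | BTV of 'I_r.-1 | BE of 'I_r.-1.

Local Notation T i := (Gen (BT i)).
Local Notation TV i := (Gen (BTV i)).
Local Notation E i := (Gen (BE i)).

Definition adjacent (i j : 'I_r.-1) : bool := (i.+1 == j) || (j.+1 == i).

Definition far (i j : 'I_r.-1) : bool := (i.+1 < j)%N || (j.+1 < i)%N.

Inductive bmw_rel : expr kap bgen -> expr kap bgen -> Prop :=
| bmw_TTV i : bmw_rel (T i * TV i) (Cst 1)
| bmw_TVT i : bmw_rel (TV i * T i) (Cst 1)
| bmw_cubic i :
    bmw_rel ((T i - Cst q) * (T i + Cst q^-1) * (T i - Cst vrho^-1)) (Cst 0)
| bmw_braid (i j : 'I_r.-1) : i.+1 = j ->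
    bmw_rel (T i * T j * T i) (T j * T i * T j)
| bmw_far i j : far i j -> bmw_rel (T i * T j) (T j * T i)
| bmw_ETE i j : adjacent i j -> bmw_rel (E i * T j * E i) (vrho *: E i)
| bmw_ETVE i j : adjacent i j -> bmw_rel (E i * TV j * E i) (vrho^-1 *: E i)
| bmw_ET i : bmw_rel (E i * T i) (vrho^-1 *: E i)
| bmw_TE i : bmw_rel (T i * E i) (vrho^-1 *: E i)
| bmw_skein i : bmw_rel (T i - TV i) ((q - q^-1) *: (Cst 1 - E i)).

Definition BMW : palg kap := Palg bmw_rel.

Definition bT (i : 'I_r.-1) : BMW := gen (A := BMW) (BT i).
Definition bE (i : 'I_r.-1) : BMW := gen (A := BMW) (BE i).

Definition is_sigma (sigma : algAntiHom BMW BMW) : Prop :=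
  involutive sigma /\
  forall i, sigma (bT i) = bT i /\ sigma (bE i) = bE i.

End BMW.

Definition varrho (g : lie_type) (n : nat) (kap : fieldType) (q : kap) : kap :=
  match g with SO => q ^+ (n.*2 - 1) | SP => - q ^+ (n.*2 + 1) end.

Definition is_bmw_action (g : lie_type) (n r : nat) (kap : fieldType) (q : kap)
    (W : rmodule (BMW r (varrho g n q) q) (Tens n kap r)) : Prop :=
  forall (i : 'I_r.-1) (I : r.-tuple 'I_n.*2),
    W (bT _ _ i) (bas kap I) = act_at (Rop g q) i I /\
    W (bE _ _ i) (bas kap I) = act_at (Eop g q) i I.

(* Main.v *)
Require Import Defs.
From HB Require Import structures.
From mathcomp Require Import all_boot all_order all_algebra.
From mathcomp Require Import zify ring.
Import GRing.Theory.
Local Open Scope ring_scope.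

Set Implicit Arguments.
Unset Strict Implicit.
Unset Printing Implicit Defensive.

(* Let wt k be the weight of v_k, and let Omega be the diagonal bilinear form on
   V^(x)r with entry q^(- sum_(a < b) (wt i_a, wt i_b)) at v_(i_1) (x) ... (x)
   v_(i_r). In the given basis e_i and f_i are transposes of each other on V, but
   the transpose of Delta(e_i) is f_i (x) 1 + k_i (x) f_i instead of Delta(f_i);
   conjugation by Omega turns one into the other, and also the divided powers,
   whose coproducts are given by the q-binomial theorem over Z[v,v^-1]. Because
   every wt k has norm 1, the entries of Omega depend only on the total weight, so
   Omega commutes with the T_i and E_i, whose matrices are symmetric. Hence Omega
   is a nondegenerate form contravariant for both actions. *)

(** * Linear and multiplicative structure of homomorphisms and actions *)

HB.instance Definition _ (R : comNzRingType) (A B : palg R) (f : algHom A B) :=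
  GRing.isLinear.Build R A B *:%R f (hom_linear f).
HB.instance Definition _ (R : comNzRingType) (A B : palg R) (f : algHom A B) :=
  GRing.isMonoidMorphism.Build A B f (hom_monoid f).
HB.instance Definition _ (R : comNzRingType) (A B : palg R)
    (f : algAntiHom A B) :=
  GRing.isLinear.Build R A B *:%R f (anti_linear f).
HB.instance Definition _ (K : fieldType) (A : palg K) (W : vectType K)
    (f : lmodule A W) :=
  GRing.isLinear.Build K A 'End(W) *:%R f (lact_linear f).
HB.instance Definition _ (K : fieldType) (A : palg K) (W : vectType K)
    (f : rmodule A W) :=
  GRing.isLinear.Build K A 'End(W) *:%R f (ract_linear f).

(** * Calculus in presented algebras and their tensor products *)

Section Presented.
Variables (R : comNzRingType) (A : palg R).

Lemma clsD (x y : expr R (gens A)) : cls (Add x y) = cls x + cls y :> A.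
Proof. by rewrite -cls_add. Qed.

Lemma clsM (x y : expr R (gens A)) : cls (Mul x y) = cls x * cls y :> A.
Proof. by rewrite -cls_mul. Qed.

Lemma clsZ a (x : expr R (gens A)) : cls (Mul (Cst a) x) = a *: cls x :> A.
Proof. by rewrite -cls_scale. Qed.

Lemma cls_cst a : cls (Cst a) = a *: (1 : A).
Proof. by rewrite -[1]/(cls (A := A) (Cst 1)) -clsZ; apply/clsP/cong_sym/cong_mul1r. Qed.

Lemma cls_rel (x y : expr R (gens A)) : rels x y -> cls x = cls y :> A.
Proof. by move=> xy; apply/clsP/cong_rel. Qed.

(** Each element is the class of a formal expression, and the constants in it are multiples of [1],
    so structural induction on the expression suffices. *)
Lemma palg_ind (P : A -> Prop) :
  (forall x, P (gen x)) -> P 1 -> (forall a x, P x -> P (a *: x)) ->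
  (forall x y, P x -> P y -> P (x + y)) ->
  (forall x y, P x -> P y -> P (x * y)) -> forall x, P x.
Proof.
move=> Pgen P1 PZ PD PM; elim/cls_ind; elim=> [x|a|x Px y Py|x Px y Py].
- exact: Pgen.
- by rewrite cls_cst; apply: PZ.
- by rewrite clsD; apply: PD.
- by rewrite clsM; apply: PM.
Qed.

Lemma pscaleAl a (x y : A) : (a *: x) * y = a *: (x * y).
Proof. exact/esym/presented_scalerAl. Qed.

Lemma pscaleAr a (x y : A) : x * (a *: y) = a *: (x * y).
Proof. exact/esym/presented_scalerAr. Qed.

End Presented.

Section TensorAlgebra.
Variables (R : comNzRingType) (A B : palg R).

Lemma tensM (a a' : A) (b b' : B) : (a ⊗ b) * (a' ⊗ b') = (a * a') ⊗ (b * b').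
Proof.
have := cls_rel (A := tensor A B) (tens_mul a a' b b').
by rewrite clsM.
Qed.

Lemma tens11 : tens (1 : A) (1 : B) = 1.
Proof. exact: (cls_rel (A := tensor A B) (tens_one A B)). Qed.

Lemma tensZl x (a : A) (b : B) : (x *: a) ⊗ b = x *: (a ⊗ b).
Proof.
have := cls_rel (A := tensor A B) (tens_scalel x a b).
by rewrite clsZ.
Qed.

Lemma tensZr x (a : A) (b : B) : a ⊗ (x *: b) = x *: (a ⊗ b).
Proof.
have := cls_rel (A := tensor A B) (tens_scaler x a b).
by rewrite clsZ.
Qed.

Lemma tensX (a : A) (b : B) m : (a ⊗ b) ^+ m = (a ^+ m) ⊗ (b ^+ m).
Proof.
by elim: m => [|m IHm]; rewrite ?expr0 ?tens11 // !exprS IHm tensM.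
Qed.

End TensorAlgebra.

(** * The q-binomial theorem for divided powers *)

Section QBinomial.
Variables (F : fieldType) (v : F) (d : nat).
Hypothesis v_neq0 : v != 0.
Hypothesis vX_neq1 : forall m, (0 < m)%N -> v ^+ m != 1.
Hypothesis d_gt0 : (0 < d)%N.

Definition qnum (m : nat) : F :=
  (v ^+ (d * m) - v ^- (d * m)) / (v ^+ d - v ^- d).

Definition qnum_fact (m : nat) : F := \prod_(1 <= i < m.+1) qnum i.

Lemma vXB_neq0 m : (0 < m)%N -> v ^+ m - v ^- m != 0.
Proof.
move=> m_gt0; have v0 : v ^+ m != 0 by rewrite expf_neq0.
rewrite subr_eq0; apply: contra_neq (vX_neq1 (m := m + m) _) => [e|]; last lia.
by rewrite exprD {2}e mulfV.
Qed.

Lemma qnum_neq0 m : (0 < m)%N -> qnum m != 0.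
Proof.
by move=> m_gt0; rewrite mulf_neq0 ?invr_neq0 ?vXB_neq0 // muln_gt0 d_gt0.
Qed.

Lemma qnum0 : qnum 0 = 0.
Proof. by rewrite /qnum muln0 expr0 invr1 subrr mul0r. Qed.

(** The mixed terms v^(da - db) cancel. This is the Pascal rule for Gaussian binomials with the
    denominators cleared. *)
Lemma qnumD a b : qnum (a + b) = v ^- (d * b) * qnum a + v ^+ (d * a) * qnum b.
Proof.
rewrite /qnum mulnDr exprD !mulrA -mulrDl; congr (_ / _).
rewrite !mulrBr invfM [v ^- _ * v ^+ _]mulrC [RHS]addrC addrA subrK.
by rewrite [v ^- (d * b) * _]mulrC.
Qed.

Lemma qnum_factS m : qnum_fact m.+1 = qnum_fact m * qnum m.+1.
Proof. by rewrite /qnum_fact big_nat_recr. Qed.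

Lemma qnum_fact0 : qnum_fact 0 = 1.
Proof. by rewrite /qnum_fact big_geq. Qed.

Variable A : palg F.
Implicit Types x y : A.

(** Stated over any presented algebra so as to cover the tensor square of [Uv] too; on [Uv] itself
    it is convertible to [divpow]. *)
Definition dpow x m : A := (qnum_fact m)^-1 *: x ^+ m.

Lemma dpowS x m : x * dpow x m = qnum m.+1 *: dpow x m.+1.
Proof.
rewrite /dpow qnum_factS pscaleAr -exprS scalerA; congr (_ *: _).
by rewrite invfM mulrCA mulfV ?mulr1 // qnum_neq0.
Qed.

Lemma qcommX x y t m : y * x = t *: (x * y) ->
  y * x ^+ m = t ^+ m *: (x ^+ m * y).
Proof.
move=> yx; elim: m => [|m IHm]; first by rewrite !expr0 mulr1 mul1r scale1r.
rewrite exprSr mulrA IHm pscaleAl -mulrA yx pscaleAr scalerA -!mulrA.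
by rewrite -exprSr.
Qed.

Lemma qcomm_dpow x y t m : y * x = t *: (x * y) ->
  y * dpow x m = t ^+ m *: (dpow x m * y).
Proof.
move=> yx; rewrite /dpow pscaleAr (qcommX _ yx) pscaleAl !scalerA.
by rewrite [_ * t ^+ m]mulrC.
Qed.

(** Divided powers absorb the Gaussian binomials, leaving pure powers of v as coefficients; hence
    the expansion makes sense over Z[v,v^-1] and can be specialised. *)
Lemma qbinomial x y m : y * x = v ^+ (d * 2) *: (x * y) ->
  dpow (x + y) m =
    \sum_(j < m.+1) v ^+ (d * (j * (m - j))) *: (dpow x j * dpow y (m - j)).
Proof.
move=> yx; elim: m => [|m IHm].
  by rewrite big_ord1 /dpow !expr0 qnum_fact0 invr1 !scale1r mulr1 muln0 expr0 scale1r.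
(* Multiplying by [qnum m.+1] turns the left side into [(x + y) * dpow (x + y) m], to which the
   induction hypothesis applies. *)
apply: (scalerI (qnum_neq0 (ltn0Sn m))).
rewrite -dpowS mulrDl IHm.
(* The index is shifted by one; the added term j = 0 vanishes because [qnum 0 = 0], whatever the
   truncated [j.-1] is. *)
have ->: x * (\sum_(j < m.+1) v ^+ (d * (j * (m - j))) *: (dpow x j * dpow y (m - j)))
  = \sum_(j < m.+2) (v ^+ (d * (j.-1 * (m.+1 - j))) * qnum j) *:
      (dpow x j * dpow y (m.+1 - j)).
  rewrite [RHS]big_ord_recl /= qnum0 mulr0 scale0r add0r mulr_sumr.
  apply: eq_bigr => j _; rewrite pscaleAr mulrA dpowS pscaleAl scalerA /bump /=.
  by rewrite add1n /= subSS.
(* Moving y past [dpow x j] costs v^(2dj), and j(m-j) + 2j = j(m+1-j) + j. Here the added term is j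
   = m+1, again with factor [qnum 0]. *)
have ->: y * (\sum_(j < m.+1) v ^+ (d * (j * (m - j))) *: (dpow x j * dpow y (m - j)))
  = \sum_(j < m.+2) (v ^+ (d * (j * (m.+1 - j) + j)) * qnum (m.+1 - j)) *:
      (dpow x j * dpow y (m.+1 - j)).
  rewrite [RHS]big_ord_recr /= (subnn m.+1) qnum0 mulr0 scale0r addr0 mulr_sumr.
  apply: eq_bigr => j _; rewrite pscaleAr mulrA (qcomm_dpow _ yx) pscaleAl.
  rewrite -mulrA dpowS pscaleAr !scalerA subSn -1?ltnS // -exprM -exprD.
  by congr ((v ^+ _ * _) *: _); lia.
rewrite -big_split scaler_sumr /=; apply: eq_bigr => j _.
rewrite -scalerDl scalerA; congr (_ *: _).
have jm : (j <= m.+1)%N by rewrite -ltnS.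
have -> : qnum m.+1 = v ^- (d * (m.+1 - j)) * qnum j + v ^+ (d * j) * qnum (m.+1 - j).
  by rewrite -qnumD subnKC.
rewrite mulrDl; congr (_ + _); last first.
  by rewrite mulrAC -exprD addnC mulnDr.
case: (posnP j) => [->|j_gt0]; first by rewrite qnum0 !(mulr0, mul0r).
rewrite mulrAC; congr (_ * _).
apply: (mulfI (expf_neq0 (d * (m.+1 - j)) v_neq0)).
rewrite mulVKf ?expf_neq0 // -exprD; congr (_ ^+ _).
by rewrite -mulnDr -mulSn prednK.
Qed.

End QBinomial.

(** * Weights of the natural representation *)

Section Dot.
Variable n : nat.
Implicit Types x y z : 'rV[int]_n.

Lemma dotC x y : dot x y = dot y x.
Proof. by apply: eq_bigr => j _; rewrite mulrC. Qed.

Lemma dotDl x y z : dot (x + y) z = dot x z + dot y z.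
Proof. by rewrite -big_split; apply: eq_bigr => j _; rewrite mxE mulrDl. Qed.

Lemma dotDr x y z : dot z (x + y) = dot z x + dot z y.
Proof. by rewrite ![dot z _]dotC dotDl. Qed.

Lemma dotNl x z : dot (- x) z = - dot x z.
Proof. by rewrite /dot -sumrN; apply: eq_bigr => j _; rewrite mxE mulNr. Qed.

Lemma dotNr x z : dot z (- x) = - dot z x.
Proof. by rewrite ![dot z _]dotC dotNl. Qed.

Lemma dot0r z : dot z 0 = 0.
Proof. by rewrite /dot big1 // => j _; rewrite mxE mulr0. Qed.

Lemma dotMnr x z m : dot z (x *+ m) = dot z x *+ m.
Proof.
by elim: m => [|m IHm]; rewrite ?mulr0n ?dot0r // !mulrS dotDr IHm.
Qed.

(** The range test is there because [eps n a] is zero for labels outside 1..n. *)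
Lemma dot_eps a b : dot (eps n a) (eps n b) = ((0 < a <= n)%N && (a == b))%:R.
Proof.
rewrite /dot; case: (boolP (0 < a <= n)%N) => [/andP[a_gt0 a_le]|aN] /=.
  have a_lt : (a.-1 < n)%N by rewrite prednK.
  rewrite (bigD1 (Ordinal a_lt)) //= big1 => [|j /eqP jN]; rewrite !mxE /= ?prednK //.
    by rewrite eqxx mul1r addr0.
  case: eqP => [ja|]; rewrite ?mul0r //; case: jN; apply: val_inj => /=.
  by rewrite -ja.
rewrite big1 // => j _; rewrite !mxE; case: eqP => [ja|]; rewrite ?mul0r //.
by case/negP: aN; rewrite -ja ltn_ord.
Qed.

End Dot.

Section Weights.
Variables (g : lie_type) (n : nat).

(** The index [k] stands for v_(k+1), which for k >= n is v_(i') with i = 2n - k, of weight minus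
    epsilon_i. *)
Definition wt (k : 'I_n.*2) : 'rV[int]_n :=
  if (k < n)%N then eps n k.+1 else - eps n (n.*2 - k).

Lemma wt_rev k : wt (rev_ord k) = - wt k.
Proof.
rewrite /wt /=; have k_lt := ltn_ord k.
have -> : (n.*2 - k.+1 < n)%N = ~~ (k < n)%N by apply/idP/idP; lia.
case: (ltnP k n) => k_n /=; last by rewrite opprK subnSK.
by congr (- eps _ _); lia.
Qed.

Lemma dot_wt k : dot (wt k) (wt k) = 1.
Proof.
have k_lt := ltn_ord k.
rewrite /wt; case: (ltnP k n) => k_n; rewrite ?(dotNl, dotNr, opprK) dot_eps eqxx.
  by rewrite k_n.
by have -> : (0 < n.*2 - k <= n)%N by lia.
Qed.

(** This includes SO with n = 1, where [eps n 0] is zero and the root has norm 1. *)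
Lemma dot_alpha_neq0 (i : 'I_n) : dot (alpha g n i.+1) (alpha g n i.+1) != 0.
Proof.
have i_lt := ltn_ord i; rewrite /alpha; case: (ltnP i.+1 n) => i_n.
  rewrite !(dotDl, dotDr, dotNl, dotNr, dot_eps); lia.
case: g; rewrite ?mulr2n !(dotDl, dotDr, dotNl, dotNr, dot_eps); lia.
Qed.

Lemma cartan_diag (i : 'I_n) : cartan g i i = 2.
Proof. by rewrite /cartan mulzK ?dot_alpha_neq0. Qed.

Variables (kap : fieldType) (q : kap).

Lemma nat_kE (i : 'I_n) (k : 'I_n.*2) :
  nat_k g n q i.+1 k.+1 = q ^ dot (alpha g n i.+1) (wt k).
Proof.
have i_lt := ltn_ord i; have k_lt := ltn_ord k.
rewrite /nat_k /alpha /wt /pr.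
case: ifP => i_n; [|move: i_n; case: g => i_n]; case: (ltnP k n) => k_n;
  rewrite ?mulr2n !(dotDl, dotNl, dotNr, dot_eps);
  repeat case: ifP => ?;
  first [by exfalso; lia |
  match goal with
  | |- 1 = _ ^ ?z => have -> : z = 0 by lia
  | |- _ ^- 2 = _ ^ ?z => have -> : z = - 2%:Z by lia
  | |- _^-1 = _ ^ ?z => have -> : z = -1 by lia
  | |- _ ^+ 2 = _ ^ ?z => have -> : z = 2 by lia
  | |- _ = _ ^ ?z => have -> : z = 1 by lia
  end; by []].
Qed.

Lemma vb_neq0 x (l : 'I_n.*2) : vb n kap x l != 0 -> x = l.+1.
Proof. by rewrite ffunE; case: (l.+1 =P x) => // _; rewrite eqxx. Qed.

Lemma vbN_neq0 x (l : 'I_n.*2) : (- vb n kap x) l != 0 -> x = l.+1.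
Proof. by rewrite ffunE oppr_eq0 => /vb_neq0. Qed.

(** The norm formula is tied to a nonzero matrix entry because it fails for SO with n = 1, where the
    entries of [nat_e] all vanish. *)
Lemma nat_e_neq0 (i : 'I_n) (k l : 'I_n.*2) :
  nat_e g n kap i.+1 k.+1 l != 0 ->
  wt l = wt k + alpha g n i.+1 /\
  dot (alpha g n i.+1) (alpha g n i.+1) = (dd g i).*2%:Z.
Proof.
have i_lt := ltn_ord i; have k_lt := ltn_ord k; have l_lt := ltn_ord l.
rewrite /nat_e /pr /alpha /dd.
case: ifP => i_n; [|move: i_n; case: g => i_n; [|have -> : i.+1 == n by lia]];
  repeat case: ifP => [/eqP ?|?]; rewrite ?[(0 : Vec n kap) l]ffunE ?eqxx //;
  (move/vb_neq0 => ? || move/vbN_neq0 => ?);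
  (split; [apply/rowP=> j; rewrite /wt; do 2 case: ifP => ?; rewrite !mxE|
   rewrite ?mulr2n !(dotDl, dotDr, dotNl, dotNr, dot_eps)]).
all: by case: g; lia.
Qed.

Lemma nat_e_f (i : 'I_n) (k l : 'I_n.*2) :
  nat_e g n kap i.+1 k.+1 l = nat_f g n kap i.+1 l.+1 k.
Proof.
have i_lt := ltn_ord i; have k_lt := ltn_ord k; have l_lt := ltn_ord l.
rewrite /nat_e /nat_f /pr /vb.
case: ifP => i_n; [|move: i_n; case: g => i_n];
  repeat case: ifP => ?; rewrite ?ffunE;
  repeat case: ifP => ?; rewrite ?ffunE;
  try (by exfalso; lia); repeat case: eqP => ? /=; rewrite ?oppr0 //; exfalso; lia.
Qed.

End Weights.

(** * Coproducts of divided powers over Q(v) *)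

Lemma v_neq0 : v != 0.
Proof. by rewrite tofrac_eq0 polyX_eq0. Qed.

Lemma vX_neq1 m : (0 < m)%N -> v ^+ m != 1.
Proof.
case: m => // m _; rewrite -tofracXn -tofrac1 tofrac_eq.
apply/eqP=> /(congr1 (fun p : {poly rat} => size p)).
by rewrite size_polyXn size_poly1.
Qed.

Lemma laurentX (F : fieldType) (x : F) m : laurent x 'X^m 0 = x ^+ m.
Proof. by rewrite /laurent map_polyXn hornerXn expr0 divr1. Qed.

Section PalgComm.
Variables (F : fieldType) (A : palg F).
Implicit Types k e : A.

Lemma conj_comm k k' e c : k' * k = 1 ->
  k * e * k' = c *: e -> k * e = c *: (e * k).
Proof. by move=> k'k kek'; rewrite -pscaleAl -kek' -mulrA k'k mulr1. Qed.

Lemma conj_comm_inv k k' e c : k * k' = 1 -> k' * k = 1 -> c != 0 ->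
  k * e = c *: (e * k) -> k' * e = c^-1 *: (e * k').
Proof.
move=> kk' k'k c0 ke; apply: (scalerI c0); rewrite scalerA mulfV // scale1r.
rewrite -pscaleAr -[X in k' * (c *: X)]mulr1 -kk' (mulrA e) -pscaleAl -ke.
by rewrite !mulrA k'k mul1r.
Qed.

Lemma hom_dpow (B : palg F) (f : algHom A B) v d (x : A) m :
  f (dpow v d x m) = dpow v d (f x) m.
Proof. by rewrite /dpow linearZ /= rmorphXn. Qed.

Lemma dpow_tensr (B : palg F) v d (x : A) (y : B) m :
  dpow v d (x ⊗ y) m = (x ^+ m) ⊗ dpow v d y m.
Proof. by rewrite /dpow tensX tensZr. Qed.

Lemma dpow_tensl (B : palg F) v d (x : A) (y : B) m :
  dpow v d (x ⊗ y) m = dpow v d x m ⊗ (y ^+ m).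
Proof. by rewrite /dpow tensX tensZl. Qed.

End PalgComm.

Section GenericAlgebra.
Variables (g : lie_type) (n : nat).
Local Notation U := (Uv g n).
Local Notation kv := (@kv g n).
Local Notation kvV := (@kvV g n).
Local Notation ev := (@ev g n).
Local Notation fv := (@fv g n).
Local Notation dd := (@dd g n).
Local Notation dpow := (@dpow _ v).

Lemma dd_gt0 i : (0 < dd i)%N.
Proof. by rewrite /Defs.dd; case: g => //; case: ifP. Qed.

Lemma divpowE d (x : U) m : divpow d x m = dpow d x m.
Proof. by []. Qed.

Lemma kv_kvV i : kv i * kvV i = 1.
Proof. by have := cls_rel (A := U) (Uv_K1 g i); rewrite clsM. Qed.

Lemma kvV_kv i : kvV i * kv i = 1.
Proof. by have := cls_rel (A := U) (Uv_KKV g i i); rewrite !clsM -(kv_kvV i). Qed.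

Lemma kv_ev i : kv i * ev i = v ^+ (dd i * 2) *: (ev i * kv i).
Proof.
have := cls_rel (A := U) (Uv_KE g i i); rewrite clsZ !clsM cartan_diag.
exact/conj_comm/kvV_kv.
Qed.

Lemma kvV_fv i : kvV i * fv i = v ^+ (dd i * 2) *: (fv i * kvV i).
Proof.
have := cls_rel (A := U) (Uv_KF g i i); rewrite clsZ !clsM cartan_diag.
(* The relation gives k f = v^(-2d) f k; passing from k to its inverse inverts the scalar. *)
rewrite -PoszM -invr_expz -exprnP => /(conj_comm (kvV_kv i)) kf.
rewrite -[v ^+ _]invrK; apply: conj_comm_inv kf => //.
- exact: kv_kvV.
- exact: kvV_kv.
- by rewrite invr_neq0 ?expf_neq0 ?v_neq0.
Qed.

Section Comul.
Variable D : algHom U (tensor U U).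
Hypothesis hD : is_comul_v D.

(** With x = e (x) 1 and y = k (x) e one has y x = v^(2d) x y, so [qbinomial] applies. The power of
    v is put into the left factor so that each term is a pure tensor of elements of U(g). *)
Lemma comul_dpow_e i m : D (divpow (dd i) (ev i) m) =
  \sum_(j < m.+1) (v ^+ (dd i * (j * (m - j))) *:
     (divpow (dd i) (ev i) j * kv i ^+ (m - j))) ⊗ divpow (dd i) (ev i) (m - j).
Proof.
have [De _ _] := hD i; rewrite divpowE hom_dpow De.
rewrite (qbinomial v_neq0 vX_neq1 (dd_gt0 i)); last first.
  by rewrite !tensM mul1r mulr1 kv_ev tensZl.
apply: eq_bigr => j _.
by rewrite (dpow_tensl v) (dpow_tensr v) tensM expr1n mul1r -tensZl.
Qed.

Lemma comul_dpow_f i m : D (divpow (dd i) (fv i) m) =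
  \sum_(j < m.+1) (v ^+ (dd i * (j * (m - j))) *:
     divpow (dd i) (fv i) (m - j)) ⊗ (divpow (dd i) (fv i) j * kvV i ^+ (m - j)).
Proof.
(* The summands are swapped: it is x = 1 (x) f and y = f (x) k^-1 that satisfy y x = v^(2d) x y. *)
have [_ Df _] := hD i; rewrite divpowE hom_dpow Df addrC.
rewrite (qbinomial v_neq0 vX_neq1 (dd_gt0 i)); last first.
  by rewrite !tensM mul1r mulr1 kvV_fv tensZr.
apply: eq_bigr => j _.
by rewrite (dpow_tensr v) (dpow_tensl v) tensM expr1n mul1r -tensZl.
Qed.

End Comul.

End GenericAlgebra.

(** * Specialisation at v = q *)

Section SpecialisedAlgebra.
Variables (g : lie_type) (n : nat) (kap : fieldType) (q : kap).
Local Notation UA := (UA g n).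
Local Notation Uk := (Uk g n q).
Implicit Types u w : UA.

(** [UA] is a bare sigma type, so products, powers and multiples by v^m are formed together with
    their membership proofs. *)
Definition uaM u w : UA := exist _ _ (inUA_mul (svalP u) (svalP w)).

Definition uaV m u : UA := exist _ _ (inUA_scale 'X^m 0 (svalP u)).

Definition uaX u m : UA := iter m (uaM u) (exist _ _ (@inUA_one g n)).

Definition kVA (i : 'I_n) : UA := exist _ _ (inUA_kV g i).

Lemma sval_uaX u m : sval (uaX u m) = sval u ^+ m.
Proof. by elim: m => [|m IHm] //=; rewrite exprS -IHm. Qed.

Lemma sval_uaV u m : sval (uaV m u) = v ^+ m *: sval u.
Proof. by rewrite /= laurentX. Qed.

Lemma gen_spec u c : gen (A := Uk) (u, c) = c *: spec q u.
Proof. by have := cls_rel (A := Uk) (Uk_scale q u c 1); rewrite clsZ mulr1. Qed.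

Lemma spec_laurent u u' p m : sval u' = laurent v p m *: sval u ->
  spec q u' = laurent q p m *: spec q u.
Proof.
move=> e; have := cls_rel (A := Uk) (Uk_balanced q 1 e).
by rewrite mulr1 -[RHS]/(gen _) gen_spec.
Qed.

(** The two elements may carry different membership proofs; the balancing relation with scalar 1
    identifies their images. *)
Lemma spec_eq u u' : sval u = sval u' -> spec q u = spec q u'.
Proof.
have l1 (F : fieldType) (x : F) : laurent x 1 0 = 1.
  by have := laurentX x 0; rewrite !expr0.
move=> e; rewrite (@spec_laurent u' u 1 0) l1 ?scale1r //.
Qed.

Lemma specM u u1 u2 : sval u = sval u1 * sval u2 ->
  spec q u = spec q u1 * spec q u2.
Proof.
by move=> e; have := cls_rel (A := Uk) (Uk_mul q 1 1 e); rewrite clsM mulr1 => /esym.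
Qed.

Lemma specD u u1 u2 : sval u = sval u1 + sval u2 ->
  spec q u = spec q u1 + spec q u2.
Proof.
by move=> e; have := cls_rel (A := Uk) (Uk_addl q 1 e); rewrite clsD.
Qed.

Lemma spec1 u : sval u = 1 -> spec q u = 1.
Proof. by move=> e; exact: (cls_rel (A := Uk) (Uk_one q e)). Qed.

Lemma spec_uaM u w : spec q (uaM u w) = spec q u * spec q w.
Proof. exact: specM. Qed.

Lemma spec_uaX u m : spec q (uaX u m) = spec q u ^+ m.
Proof.
elim: m => [|m IHm]; first by rewrite expr0; apply: spec1.
by rewrite exprS -IHm -spec_uaM.
Qed.

Lemma spec_uaV u m : spec q (uaV m u) = q ^+ m *: spec q u.
Proof. by rewrite -laurentX; apply: spec_laurent. Qed.

Lemma spec_kkV i : spec q (kA g i) * spec q (kVA i) = 1.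
Proof. by rewrite -spec_uaM; apply: spec1; rewrite /= kv_kvV. Qed.

Lemma spec_kVk i : spec q (kVA i) * spec q (kA g i) = 1.
Proof. by rewrite -spec_uaM; apply: spec1; rewrite /= kvV_kv. Qed.

Lemma spec_e0 (i : 'I_n) : spec q (eA g i 0) = 1.
Proof. by apply: spec1; rewrite /= divpowE /dpow /qnum_fact big_geq // invr1 scale1r. Qed.

Lemma spec_f0 (i : 'I_n) : spec q (fA g i 0) = 1.
Proof. by apply: spec1; rewrite /= divpowE /dpow /qnum_fact big_geq // invr1 scale1r. Qed.

(** The presentation of [Uk] has every pair (u, c) as a generator; induction on the membership of u
    in U(g) cuts these down to divided powers and the k_i^(+-1). *)
Lemma Uk_ind (P : Uk -> Prop) :
  (forall i m, P (spec q (eA g i m))) -> (forall i m, P (spec q (fA g i m))) ->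
  (forall i, P (spec q (kA g i))) -> (forall i, P (spec q (kVA i))) ->
  P 1 -> (forall a x, P x -> P (a *: x)) ->
  (forall x y, P x -> P y -> P (x + y)) ->
  (forall x y, P x -> P y -> P (x * y)) -> forall x, P x.
Proof.
move=> Pe Pf Pk PkV P1 PZ PD PM; apply: palg_ind => // -[[u pu] c].
rewrite gen_spec; apply: (PZ).
(* The membership proof in the goal is kept separate from the one being analysed; [Peq] passes
   between them. *)
suff Pw (w : Uv g n) (pw : inUA w) : P (spec q (exist _ w pw)) by exact: Pw.
have Peq (u1 u2 : UA) : sval u1 = sval u2 -> P (spec q u1) -> P (spec q u2).
  by move/spec_eq->.
elim: {u pu c} pw (pw) => [i m|i m|i|i||x y px Px py Py|x y px Px py Py|p m x px Px] pw.
- exact: Peq (Pe i m).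
- exact: Peq (Pf i m).
- exact: Peq (Pk i).
- exact: Peq (PkV i).
- by rewrite spec1.
- rewrite (@specD _ (exist _ _ px) (exist _ _ py)) //.
  by apply: PD; [exact: Px|exact: Py].
- rewrite (@specM _ (exist _ _ px) (exist _ _ py)) //.
  by apply: PM; [exact: Px|exact: Py].
- by rewrite (@spec_laurent (exist _ _ px) _ p m) //; apply: PZ; exact: Px.
Qed.


Variable D : algHom Uk (tensor Uk Uk).
Hypothesis hD : is_comul D.

Lemma comul_k i : D (spec q (kA g i)) = spec q (kA g i) ⊗ spec q (kA g i).
Proof.
have [Dv hDv DE] := hD; rewrite (DE (kA g i) [:: (kA g i, kA g i)]) big_seq1 //.
by have [_ _] := hDv i.
Qed.

Lemma comul_e i m : D (spec q (eA g i m)) =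
  \sum_(j < m.+1) (q ^+ (dd g i * (j * (m - j))) *:
     (spec q (eA g i j) * spec q (kA g i) ^+ (m - j))) ⊗ spec q (eA g i (m - j)).
Proof.
have [Dv hDv DE] := hD.
(* The decomposition over U(g) that [is_comul] asks for, read off from [comul_dpow_e]. *)
pose t (j : 'I_m.+1) := (uaV (dd g i * (j * (m - j)))
  (uaM (eA g i j) (uaX (kA g i) (m - j))), eA g i (m - j)).
rewrite (DE _ [seq t j | j <- index_enum 'I_m.+1]) big_map.
  by apply: eq_bigr => j _; rewrite /t /= spec_uaV spec_uaM spec_uaX.
rewrite -[sval _]/(divpow (dd g i) (ev g i) m) (comul_dpow_e hDv); apply: eq_bigr => j _.
by rewrite [sval (t j).1]sval_uaV /= sval_uaX.
Qed.

Lemma comul_f i m : D (spec q (fA g i m)) =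
  \sum_(j < m.+1) (q ^+ (dd g i * (j * (m - j))) *: spec q (fA g i (m - j))) ⊗
     (spec q (fA g i j) * spec q (kVA i) ^+ (m - j)).
Proof.
have [Dv hDv DE] := hD.
pose t (j : 'I_m.+1) := (uaV (dd g i * (j * (m - j))) (fA g i (m - j)),
  uaM (fA g i j) (uaX (kVA i) (m - j))).
rewrite (DE _ [seq t j | j <- index_enum 'I_m.+1]) big_map.
  by apply: eq_bigr => j _; rewrite /t /= spec_uaV spec_uaM spec_uaX.
rewrite -[sval _]/(divpow (dd g i) (fv g i) m) (comul_dpow_f hDv); apply: eq_bigr => j _.
by rewrite [sval (t j).1]sval_uaV /= sval_uaX.
Qed.

End SpecialisedAlgebra.

(** * Coordinates in the standard basis *)

Section Bas.
Variables (kap : fieldType) (I : finType).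
Local Notation W := {ffun I -> kap^o}.

Lemma basE (i j : I) : bas kap i j = (j == i)%:R :> kap.
Proof. by rewrite ffunE. Qed.

Lemma ffunDE (x y : W) i : (x + y) i = (x i : kap) + y i.
Proof. by rewrite ffunE. Qed.

Lemma ffunNE (x : W) i : (- x) i = - (x i : kap).
Proof. by rewrite ffunE. Qed.

Lemma ffunZE a (x : W) i : (a *: x) i = a * x i.
Proof. by rewrite ffunE. Qed.

Lemma sum_bas (x : W) : x = \sum_i x i *: bas kap i.
Proof.
apply/ffunP => j; rewrite sum_ffunE (bigD1 j) //= big1 => [|i ij].
  by rewrite ffunE basE eqxx addr0; exact/esym/mulr1.
by rewrite ffunE basE eq_sym (negPf ij) scaler0.
Qed.

Lemma lfun_basP (U : vectType kap) (f f' : 'Hom(W, U)) :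
  (forall i, f (bas kap i) = f' (bas kap i)) -> f = f'.
Proof.
move=> ff'; apply/lfunP => x; rewrite [x]sum_bas !linear_sum.
by apply: eq_bigr => i _; rewrite !linearZ /= ff'.
Qed.

End Bas.

(** * The exponent of Omega *)

Section Omega.
Variable n : nat.
Implicit Types s : seq 'I_n.*2.

Definition wts s : 'rV[int]_n := \sum_(k <- s) wt k.

Fixpoint wt_pairs s : int :=
  if s is k :: s' then dot (wt k) (wts s') + wt_pairs s' else 0.

Lemma wts_cons k s : wts (k :: s) = wt k + wts s.
Proof. by rewrite /wts big_cons. Qed.

(** In the norm of the total weight each diagonal term contributes 1 and each pair a < b occurs
    twice. *)
Lemma wt_pairsE s : wt_pairs s *+ 2 + (size s)%:Z = dot (wts s) (wts s).
Proof.
elim: s => [|k s IHs] /=; first by rewrite /wts big_nil dot0r.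
rewrite wts_cons !(dotDl, dotDr) dot_wt -IHs (dotC (wts s)).
lia.
Qed.

Lemma eq_wt_pairs s s' : size s = size s' -> wts s = wts s' ->
  wt_pairs s = wt_pairs s'.
Proof.
move=> es ew; have := wt_pairsE s; rewrite ew es -wt_pairsE; lia.
Qed.

End Omega.

Lemma exprzMn (F : fieldType) (x : F) (z : int) m : (x ^ z) ^+ m = x ^ (z *+ m).
Proof. by rewrite exprnP exprz_exp -mulr_natr natz. Qed.

Lemma mulr_shuffle (F : fieldType) (a w b c x : F) :
  a * w * (b * (c * x)) = a * b * (c * (w * x)).
Proof.
rewrite -!mulrA; congr (_ * _).
by rewrite mulrCA; congr (_ * _); exact: mulrCA.
Qed.

(** * Adjointness of divided powers on tensor powers of V *)

Section TensorPower.
Variables (g : lie_type) (n : nat) (kap : fieldType) (q : kap).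
Hypothesis q_neq0 : q != 0.
Local Notation Uk := (Uk g n q).
Local Notation Vec := (Vec n kap).
Local Notation Tens := (Tens n kap).
Local Notation bas := (bas kap).
Local Notation e i m := (spec q (eA g i m)).
Local Notation f i m := (spec q (fA g i m)).
Local Notation k i := (spec q (kA g i)).
Local Notation kV i := (spec q (kVA g i)).

Lemma tensSZl r a (x : Vec) (y : Tens r) : tensS (a *: x) y = a *: tensS x y.
Proof. by apply/ffunP => I; rewrite !ffunE -scalerAl. Qed.

Lemma tensSZr r a (x : Vec) (y : Tens r) : tensS x (a *: y) = a *: tensS x y.
Proof. by apply/ffunP => I; rewrite !ffunE -scalerAr. Qed.

Lemma tensS0l r (y : Tens r) : tensS 0 y = 0.
Proof. by rewrite -(scale0r (0 : Vec)) tensSZl scale0r. Qed.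

Lemma tensS_bas r (J : r.+1.-tuple 'I_n.*2) :
  bas J = tensS (bas (thead J)) (bas [tuple of behead J]).
Proof.
apply/ffunP => I; rewrite !ffunE -natrM mulnb; congr (nat_of_bool _)%:R.
case/tupleP: I => i I; case/tupleP: J => j J.
by rewrite !theadE -!val_eqE /= eqseq_cons.
Qed.

Lemma tens1_bas (J : 1.-tuple 'I_n.*2) : bas J = tens1 (bas (thead J)).
Proof.
apply/ffunP => I; rewrite !ffunE; congr (nat_of_bool _)%:R.
case/tupleP: I => i I; case/tupleP: J => j J.
by rewrite !theadE -!val_eqE /= (tuple0 I) (tuple0 J) eqseq_cons /= andbT.
Qed.

Section Modules.
Variables (W : vectType kap) (M : lmodule Uk W).

Lemma lactX a m x : M (a ^+ m) x = iter m (M a) x.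
Proof.
elim: m => [|m IHm]; first by rewrite expr0 lact_one id_lfunE.
by rewrite exprS lact_mul comp_lfunE IHm.
Qed.

Lemma lactX_eigen a m c x : M a x = c *: x -> M (a ^+ m) x = c ^+ m *: x.
Proof.
move=> ax; rewrite lactX; elim: m => [|m IHm]; first by rewrite scale1r.
by rewrite iterS IHm linearZ /= ax scalerA exprSr.
Qed.

Lemma lact_kV i c x : c != 0 -> M (k i) x = c *: x -> M (kV i) x = c^-1 *: x.
Proof.
move=> c0 kx; apply: (scalerI c0); rewrite scalerA mulfV // scale1r.
by rewrite -linearZ /= -kx -comp_lfunE -lact_mul spec_kVk lact_one id_lfunE.
Qed.

End Modules.

Definition om (s : seq 'I_n.*2) : kap := q ^ (- wt_pairs s).

(** The invariant of the induction on the number of factors. The last clause is adjointness of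
    e_i^(m) and f_i^(m) under Omega; the weight clauses make the powers of q match when a factor is
    added. *)
Definition compatible r (M : lmodule Uk (Tens r)) : Prop :=
  forall i,
  [/\ forall J, M (k i) (bas J) = q ^ dot (alpha g n i.+1) (wts J) *: bas J,
      forall m (J L : r.-tuple 'I_n.*2), M (e i m) (bas J) L != 0 :> kap ->
        wts L = wts J + alpha g n i.+1 *+ m &
      forall m (J L : r.-tuple 'I_n.*2),
        om L * M (e i m) (bas J) L = om J * M (f i m) (bas L) J].

Variable V : lmodule Uk Vec.
Hypothesis hV : is_natural V.

Lemma nat_e_ge2 i m : (2 <= m)%N -> V (e i m) = 0.
Proof.
move=> m2; apply: lfun_basP => j; rewrite zero_lfunE.
by have [_ _ _ V0 _] := hV i j; exact: V0.
Qed.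

Lemma nat_f_ge2 i m : (2 <= m)%N -> V (f i m) = 0.
Proof.
move=> m2; apply: lfun_basP => j; rewrite zero_lfunE.
by have [_ _ _ _ V0] := hV i j; exact: V0.
Qed.

Lemma nat_k_bas i j : V (k i) (bas j) = q ^ dot (alpha g n i.+1) (wt j) *: bas j.
Proof. by have [_ _ -> _ _] := hV i j; rewrite nat_kE. Qed.

Lemma nat_e_wt i j l : V (e i 1) (bas j) l != 0 :> kap ->
  wt l = wt j + alpha g n i.+1 /\
  dot (alpha g n i.+1) (alpha g n i.+1) = (dd g i).*2%:Z.
Proof. by have [-> _ _ _ _] := hV i j => /(nat_e_neq0). Qed.

Lemma nat_e_fV i j l :
  V (e i 1) (bas j) l = V (f i 1) (bas l) j :> kap.
Proof.
by have [-> _ _ _ _] := hV i j; have [_ -> _ _ _] := hV i l; exact: nat_e_f.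
Qed.

(** A single factor has no pairs, so Omega is the identity and only the transposition of e_i and f_i
    on V is left. *)
Lemma compatible1 (M : lmodule Uk (Tens 1)) :
  (forall u x, M u (tens1 x) = tens1 (V u x)) -> compatible M.
Proof.
move=> MV i; have wts1 (J : 1.-tuple 'I_n.*2) : wts J = wt (thead J).
  by case/tupleP: J => j J; rewrite theadE tuple0 /wts big_seq1.
have om1 (J : 1.-tuple 'I_n.*2) : om J = 1.
  by case/tupleP: J => j J; rewrite tuple0 /om /= /wts big_nil dot0r.
split=> [J|m J L|m J L].
- rewrite tens1_bas MV nat_k_bas wts1; apply/ffunP => I.
  by rewrite !ffunE.
- rewrite tens1_bas MV ffunE !wts1.
  case: m => [|[|m]]; last by rewrite nat_e_ge2 // zero_lfunE ffunE eqxx.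
    rewrite spec_e0 lact_one id_lfunE basE mulr0n addr0.
    by case: (thead L =P thead J) => [-> | _] //; rewrite eqxx.
  by rewrite mulr1n => /nat_e_wt[].
- rewrite !tens1_bas !MV !ffunE !om1 !mul1r.
  case: m => [|[|m]]; last by rewrite nat_e_ge2 ?nat_f_ge2 // !zero_lfunE !ffunE.
    by rewrite spec_e0 spec_f0 !lact_one !id_lfunE !basE eq_sym.
  exact: nat_e_fV.
Qed.

Variable D : algHom Uk (tensor Uk Uk).
Hypothesis hD : is_comul D.

Section Step.
Variables (r : nat) (M : lmodule Uk (Tens r)) (M' : lmodule Uk (Tens r.+1)).
Hypothesis M'E : forall u (s : seq (Uk * Uk)), D u = \sum_(p <- s) p.1 ⊗ p.2 ->
  forall x y, M' u (tensS x y) = \sum_(p <- s) tensS (V p.1 x) (M p.2 y).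

Lemma tensor_k i x y : M' (k i) (tensS x y) = tensS (V (k i) x) (M (k i) y).
Proof.
by rewrite (M'E (s := [:: (k i, k i)])) big_seq1 //; exact: comul_k.
Qed.

(** Divided powers of order at least 2 kill V, so only the terms j = 0, 1 of the coproduct
    survive. *)
Lemma tensor_eS i m x y : M' (e i m.+1) (tensS x y) =
  tensS (V (k i ^+ m.+1) x) (M (e i m.+1) y) +
  q ^+ (dd g i * m) *: tensS (V (e i 1) (V (k i ^+ m) x)) (M (e i m) y).
Proof.
pose t (j : 'I_m.+2) := (q ^+ (dd g i * (j * (m.+1 - j))) *:
     (e i j * k i ^+ (m.+1 - j)), e i (m.+1 - j)).
rewrite (M'E (s := [seq t j | j <- index_enum 'I_m.+2])) big_map; last first.
  exact: comul_e.
rewrite 2!big_ord_recl big1 ?addr0 => [|j _]; last first.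
  rewrite /= linearZ /= scale_lfunE lact_mul comp_lfunE nat_e_ge2 // zero_lfunE.
  rewrite scaler0 tensS0l.
  by [].
rewrite /t /= /bump /= subn0 subn1 /= !linearZ /= !scale_lfunE !tensSZl.
rewrite mul0n muln0 expr0 scale1r mul1n spec_e0 mul1r; congr (_ + _).
by rewrite lact_mul comp_lfunE.
Qed.

(** Here the left tensor factor is a multiple of f_i^(m+1-j), so the surviving terms are the last
    two, j = m and j = m+1. *)
Lemma tensor_fS i m x y : M' (f i m.+1) (tensS x y) =
  tensS x (M (f i m.+1) y) +
  q ^+ (dd g i * m) *: tensS (V (f i 1) x) (M (f i m) (M (kV i) y)).
Proof.
pose t (j : 'I_m.+2) := (q ^+ (dd g i * (j * (m.+1 - j))) *: f i (m.+1 - j),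
  f i j * kV i ^+ (m.+1 - j)).
rewrite (M'E (s := [seq t j | j <- index_enum 'I_m.+2])) big_map; last first.
  exact: comul_f.
rewrite 2!big_ord_recr big1 ?add0r => [|j _] /=; last first.
  rewrite linearZ /= scale_lfunE nat_f_ge2 ?zero_lfunE ?scaler0 ?tensS0l //.
  by have := ltn_ord j; lia.
rewrite add0r addrC subnn subSnn spec_f0 expr0 mulr1 !muln0 muln1 expr1 lact_mul.
by rewrite comp_lfunE !linearZ /= !scale_lfunE lact_one id_lfunE tensSZl scale1r tensSZl.
Qed.

Lemma bas_cons j (J : r.-tuple 'I_n.*2) :
  bas [tuple of j :: J] = tensS (bas j) (bas J).
Proof. by rewrite tensS_bas theadE; congr (tensS _ (bas _)); apply: val_inj. Qed.

Lemma tensS_cons (x : Vec) (y : Tens r) j (J : r.-tuple 'I_n.*2) :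
  tensS x y [tuple of j :: J] = (x j : kap) * y J.
Proof. by rewrite ffunE theadE; congr (_ * y _); apply: val_inj. Qed.

Lemma om_cons j s : om (j :: s) = q ^ (- dot (wt j) (wts s)) * om s.
Proof. by rewrite /om /= opprD expfzDr. Qed.

Hypothesis hM : compatible M.
Implicit Types J L : r.-tuple 'I_n.*2.

Lemma tensor_e_entry i m j J l L :
  M' (e i m.+1) (bas [tuple of j :: J]) [tuple of l :: L] =
  q ^ (dot (alpha g n i.+1) (wt j) *+ m.+1) *
    ((l == j)%:R * M (e i m.+1) (bas J) L) +
  q ^ ((dd g i * m)%:Z + dot (alpha g n i.+1) (wt j) *+ m) *
    (V (e i 1) (bas j) l * M (e i m) (bas J) L).
Proof.
rewrite bas_cons tensor_eS !(lactX_eigen _ (nat_k_bas i j)) linearZ /=.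
rewrite !tensSZl scalerA ffunDE !ffunZE !tensS_cons basE expfzDr //.
by rewrite !exprzMn.
Qed.

Lemma tensor_f_entry i m j J l L :
  M' (f i m.+1) (bas [tuple of l :: L]) [tuple of j :: J] =
  (l == j)%:R * M (f i m.+1) (bas L) J +
  q ^ ((dd g i * m)%:Z - dot (alpha g n i.+1) (wts L)) *
    (V (f i 1) (bas l) j * M (f i m) (bas L) J).
Proof.
have [kL _ _] := hM i.
rewrite bas_cons tensor_fS (lact_kV _ (kL L)) ?expfz_neq0 // linearZ /=.
rewrite tensSZr scalerA ffunDE !ffunZE !tensS_cons basE eq_sym expfzDr // invr_expz.
by [].
Qed.

Lemma compatibleS : compatible M'.
Proof.
move=> i; have [kM eM symM] := hM i; split=> [J|m J L|m J L].
- case/tupleP: J => j J; rewrite bas_cons tensor_k nat_k_bas kM.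
  by rewrite tensSZl tensSZr scalerA wts_cons dotDr expfzDr.
- case/tupleP: J => j J; case/tupleP: L => l L; rewrite !wts_cons.
  case: m => [|m].
    rewrite spec_e0 lact_one id_lfunE basE mulr0n addr0.
    by case: (_ =P _ :> _.-tuple _) => [[-> ->] | _] //; rewrite eqxx.
  rewrite tensor_e_entry => nz.
  (* One of the two summands of the entry is nonzero. The root is added m+1 times in the tail, or
     once in the head and m times in the tail. *)
  have [El|El] := eqVneq ((l == j)%:R * M (e i m.+1) (bas J) L : kap) 0.
    have: V (e i 1) (bas j) l * M (e i m) (bas J) L != 0 :> kap.
      by apply: contra_neq nz => ->; rewrite El !mulr0 addr0.
    rewrite mulf_eq0 negb_or => /andP[/nat_e_wt[-> _] /eM->].
    by rewrite mulrSr addrACA [_ + _ *+ m]addrC.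
  have: M (e i m.+1) (bas J) L != 0 :> kap by apply: contra_neq El => ->; rewrite mulr0.
  by move/eM->; move: El; case: (l =P j) => [-> _|_]; rewrite ?mul0r ?eqxx ?addrA.
- case: m => [|m].
    rewrite spec_e0 spec_f0 !lact_one !id_lfunE !basE.
    by case: (eqVneq L J) => [->|_]; rewrite ?mulr0.
  case/tupleP: J => j J; case/tupleP: L => l L.
  (* The two summands match separately. In the first, l = j and the tail gains (m+1) alpha, so -(wt
     j, wts L) + (m+1)(alpha, wt j) = -(wt j, wts J). *)
  rewrite tensor_e_entry tensor_f_entry !om_cons !mulrDr; congr (_ + _).
    case: (eqVneq l j) => [->|]; last by rewrite !(mul0r, mulr0).
    rewrite !mul1r -[RHS]mulrA -symM mulrACA -expfzDr //.
    have [->|/eM->] := eqVneq (M (e i m.+1) (bas J) L : kap) 0; first by rewrite !mulr0.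
    congr (q ^ _ * _).
    by rewrite dotDr dotMnr (dotC (wt j) (alpha _ _ _)) opprD subrK.
  rewrite -nat_e_fV.
  have [->|/nat_e_wt[wl dd2]] := eqVneq (V (e i 1) (bas j) l : kap) 0.
    by rewrite !(mul0r, mulr0).
  rewrite [LHS]mulr_shuffle [RHS]mulr_shuffle -symM -!expfzDr //.
  have [->|/eM wL] := eqVneq (M (e i m) (bas J) L : kap) 0; first by rewrite !mulr0.
  (* With wt l = wt j + alpha and wts L = wts J + m alpha, both exponents equal -(wt j, wts J) -
     (alpha, wts L) + d m. *)
  congr (q ^ _ * _); rewrite wl wL !(dotDl, dotDr, dotMnr) dd2.
  rewrite (dotC (wt j) (alpha _ _ _)); ring.
Qed.

End Step.

Lemma tensor_power_compatible r (M : lmodule Uk (Tens r)) :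
  tensor_power D V M -> compatible M.
Proof.
elim=> {r M} [M MV|r M M' _ IH M'E]; first exact: compatible1.
exact: compatibleS M'E IH.
Qed.

End TensorPower.

(** * Symmetry and weight preservation of R and E *)

Section LocalOperators.
Variables (g : lie_type) (n : nat) (kap : fieldType) (q : kap).
Implicit Types k l a b : 'I_n.*2.
Local Notation op_type := ('I_n.*2 -> 'I_n.*2 -> {ffun 'I_n.*2 * 'I_n.*2 -> kap^o}).

Definition op_sym (op : op_type) : Prop :=
  forall k l a b, op k l (a, b) = op a b (k, l) :> kap.

Definition op_wt (op : op_type) : Prop :=
  forall k l a b, op k l (a, b) != 0 :> kap -> wt a + wt b = wt k + wt l.

Lemma vvE k l a b : vv kap k l (a, b) = ((a == k) && (b == l))%:R :> kap.
Proof. by rewrite basE xpair_eqE. Qed.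

Lemma rev_ord_neq k : rev_ord k != k.
Proof. by rewrite -val_eqE /=; have := ltn_ord k; lia. Qed.

Lemma rho_rev k : rho g (rev_ord k) = - rho g k.
Proof.
have := ltn_ord k; rewrite /rho /= => k_lt.
have -> : (n.*2 - k.+1 < n)%N = ~~ (k < n)%N by apply/idP/idP; lia.
by case: g; case: ltnP => /= ?; lia.
Qed.

(** For sp_(2n) reversal negates each of the two signs, so their product is kept. *)
Lemma sgn_rev k l : sgn g kap (rev_ord k) * sgn g kap (rev_ord l) =
  sgn g kap k * sgn g kap l.
Proof.
have lt_rev (j : 'I_n.*2) : (rev_ord j < n)%N = ~~ (j < n)%N.
  by have := ltn_ord j => /= j_lt; apply/idP/idP; lia.
rewrite /sgn !lt_rev; case: g => //.
by do 2 case: (_ < n)%N; rewrite /= ?mulr1 ?mul1r ?mulrNN ?mulr1.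
Qed.

Lemma RsumE k a b : Rsum g q k (a, b) =
  if (a == rev_ord b) && (k < b)%N
  then q ^ (rho g b - rho g k) * sgn g kap b * sgn g kap k else 0 :> kap.
Proof.
rewrite /Rsum sum_ffunE.
transitivity (\sum_(i : 'I_n.*2 | (k < i)%N)
  (q ^ (rho g i - rho g k) * sgn g kap i * sgn g kap k) *
    ((a == rev_ord i) && (b == i))%:R).
  by apply: eq_bigr => i _; rewrite ffunZE vvE.
case: ifP => [/andP[/eqP-> kb]|ab].
  rewrite (bigD1 b) //= big1 => [|i /andP[_ ib]]; rewrite ?eqxx ?addr0 ?mulr1 //.
  by rewrite [b == i]eq_sym (negPf ib) andbF mulr0.
rewrite big1 // => i ki; case: (b =P i) => [bi|_]; last by rewrite andbF mulr0.
by move: ab; rewrite bi ki !andbT => ->; rewrite mulr0.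
Qed.

(** One formula for the branches k > l and k < l with k = l', since l' never equals l; the middle
    term is the only difference between them. *)
Lemma Rop_revE l a b : Rop g q (rev_ord l) l (a, b) =
  ((a == l) && (b == rev_ord l))%:R * q^-1 +
  (q - q^-1) * ((rev_ord l < l)%N && (a == rev_ord l) && (b == l))%:R
  - (q - q^-1) * Rsum g q (rev_ord l) (a, b) :> kap.
Proof.
rewrite /Rop (negPf (rev_ord_neq l)) eqxx.
have := rev_ord_neq l; rewrite -val_eqE.
case: (ltngtP (rev_ord l) l) => // kk _;
  rewrite !(ffunDE, ffunZE, ffunNE) !vvE ![q^-1 * _]mulrC /= ?mulr0 ?addr0 //.
by rewrite mulrDr mulrN addrA.
Qed.

Lemma RopE k l a b : k != rev_ord l -> Rop g q k l (a, b) =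
  (if k == l then q else 1) * ((a == l) && (b == k))%:R +
  (q - q^-1) * ((k < l)%N && (a == k) && (b == l))%:R :> kap.
Proof.
move=> kl; rewrite /Rop (negPf kl).
case: (eqVneq k l) => [->|kl']; first by rewrite ffunZE vvE ltnn mulr0 addr0.
rewrite mul1r; case: (ltngtP k l) => [kl0|kl0|/val_inj kl0] /=.
- by rewrite ffunDE ffunZE !vvE.
- by rewrite vvE mulr0 addr0.
- by rewrite kl0 eqxx in kl'.
Qed.

(** R preserves the span of the v_k (x) v_(k') and the span of the remaining basis tensors. *)
Lemma Rop_rev0 k l a b : (k == rev_ord l) != (a == rev_ord b) ->
  Rop g q k l (a, b) = 0 :> kap.
Proof.
case: (eqVneq k (rev_ord l)) => [->|kl]; case: (eqVneq a (rev_ord b)) => // ab _.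
  rewrite Rop_revE RsumE (negPf ab) mulr0 subr0 -andbA.
  have -> : (a == l) && (b == rev_ord l) = false.
    by apply: contraNF ab => /andP[/eqP-> /eqP->]; rewrite rev_ordK.
  have -> : (a == rev_ord l) && (b == l) = false.
    by apply: contraNF ab => /andP[/eqP-> /eqP->].
  by rewrite andbF mulr0 mul0r addr0.
rewrite RopE // ab.
have -> : (rev_ord b == l) && (b == k) = false.
  by apply: contraNF kl => /andP[/eqP<- /eqP->]; rewrite rev_ordK.
rewrite -andbA; have -> : (rev_ord b == k) && (b == l) = false.
  by apply: contraNF kl => /andP[/eqP<- /eqP->].
by rewrite andbF !mulr0 addr0.
Qed.

(** Both blocks are treated apart: off the pairs (k, k') the matrix is a weighted flip plus a
    diagonal part, and on them symmetry comes from rho being odd under reversal. *)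
Lemma Rop_sym : op_sym (Rop g q).
Proof.
move=> k l a b.
have [e|e] := eqVneq (k == rev_ord l) (a == rev_ord b); last first.
  by rewrite [LHS]Rop_rev0 // [RHS]Rop_rev0 // eq_sym.
have [kl|kl] := eqVneq k (rev_ord l); last first.
  have ab : a != rev_ord b by rewrite -e.
  rewrite [LHS](RopE a b kl) [RHS](RopE k l ab).
  rewrite [k == b]eq_sym [l == a]eq_sym [k == a]eq_sym [l == b]eq_sym.
  rewrite [(b == k) && _]andbC; congr (_ + _).
    case: (eqVneq a l) => [->|_]; case: (eqVneq b k) => [->|_];
      by rewrite ?mulr0 // eq_sym.
  by case: (eqVneq a k) => [->|_]; case: (eqVneq b l) => [->|_]; rewrite ?andbF.
have/esym/eqP ab := e; rewrite kl eqxx in ab.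
rewrite kl ab [LHS]Rop_revE [RHS]Rop_revE [in LHS]RsumE [in RHS]RsumE !eqxx !andTb.
(* Reversal is an order-reversing involution, so the range of the sum is symmetric too. *)
have -> : (rev_ord l < b)%N = (rev_ord b < l)%N.
  by have := ltn_ord l; have := ltn_ord b => /=; lia.
rewrite !rho_rev !opprK [rho g b + _]addrC.
congr (_ + _ - _ * _).
- by rewrite [l == rev_ord b]eq_sym [rev_ord l == b]eq_sym [(rev_ord b == l) && _]andbC.
- by case: (eqVneq b l) => [->|bl]; rewrite ?andbF // eqxx.
- case: ifP => // _; rewrite -!mulrA -(sgn_rev b) rev_ordK.
  by congr (_ * _); exact: mulrC.
Qed.

(** On the pairs (k, k') both total weights are zero; elsewhere the output indices permute the input
    ones. *)
Lemma Rop_wt : op_wt (Rop g q).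
Proof.
move=> k l a b.
have [e|e] := eqVneq (k == rev_ord l) (a == rev_ord b); last first.
  by rewrite Rop_rev0 ?eqxx.
have [kl|kl] := eqVneq k (rev_ord l) => [_|].
  by move: e; rewrite kl eqxx => /esym/eqP->; rewrite !wt_rev !addNr.
rewrite RopE //; have [/andP[/eqP-> /eqP->] _|_] := boolP ((a == l) && (b == k)).
  exact: addrC.
have [/andP[/eqP-> /eqP->] //|] := boolP ((a == k) && (b == l)).
by rewrite -andbA => /negPf->; rewrite andbF !mulr0 addr0 eqxx.
Qed.

Lemma EopE k l a b : Eop g q k l (a, b) =
  if (k == rev_ord l) && (a == rev_ord b) then
    q ^ (rho g b - rho g k) * sgn g kap b * sgn g kap k else 0 :> kap.
Proof.
rewrite /Eop; case: (k == rev_ord l); last by rewrite ffunE.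
rewrite sum_ffunE (bigD1 a) //= big1 => [|i ia]; last first.
  by rewrite ffunZE vvE eq_sym (negPf ia) mulr0.
rewrite addr0 ffunZE vvE eqxx /=; case: (eqVneq b (rev_ord a)) => [->|ba].
  by rewrite rev_ordK eqxx mulr1.
by rewrite mulr0 [a == _]eq_sym (can2_eq rev_ordK rev_ordK) (negPf ba).
Qed.

Lemma Eop_sym : op_sym (Eop g q).
Proof.
move=> k l a b; rewrite !EopE [X in if X then _ else _]andbC.
case: ifP => // /andP[/eqP-> /eqP->]; rewrite !rho_rev -!mulrA.
rewrite !opprK [rho g l + _]addrC; congr (_ * _).
by rewrite -sgn_rev rev_ordK mulrC.
Qed.

Lemma Eop_wt : op_wt (Eop g q).
Proof.
move=> k l a b; rewrite EopE; case: ifP; rewrite ?eqxx // => /andP[/eqP-> /eqP->] _.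
by rewrite !wt_rev !addNr.
Qed.

Section ActAt.
Variables (r : nat) (i : 'I_r.-1) (op : op_type).
Implicit Types J L : r.-tuple 'I_n.*2.

Definition agree_off J L :=
  [forall j, (j != pos i) && (j != Defs.next i) ==> (tnth L j == tnth J j)].

Lemma pos_neq_next : pos i != Defs.next i.
Proof. by rewrite -val_eqE /= neq_ltn ltnSn. Qed.

Lemma act_atE J L : act_at op i J L = (agree_off J L)%:R *
  op (tnth J (pos i)) (tnth J (Defs.next i))
    (tnth L (pos i), tnth L (Defs.next i)) :> kap.
Proof.
(* Hence at L only the summand whose (a, b) is read off from L itself survives in the double sum. *)
have LE a b : (L == [tuple if j == pos i then a else if j == Defs.next i then b
    else tnth J j | j < r]) =
    [&& agree_off J L, tnth L (pos i) == a & tnth L (Defs.next i) == b].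
  have np := pos_neq_next.
  apply/eqP/and3P => [->|[/forallP JL /eqP La /eqP Lb]].
    split; rewrite ?tnth_mktuple ?eqxx // 1?[Defs.next i == _]eq_sym ?(negPf np) ?eqxx //.
    by apply/forallP => j; rewrite tnth_mktuple; apply/implyP => /andP[/negPf-> /negPf->].
  apply: eq_from_tnth => j; rewrite tnth_mktuple.
  case: eqP => [->//|/eqP jp]; case: eqP => [->//|/eqP jn].
  by have := JL j; rewrite jp jn => /eqP.
rewrite /act_at sum_ffunE (bigD1 (tnth L (pos i))) //=.
rewrite [X in _ + X]big1 => [|a aL]; last first.
  rewrite sum_ffunE big1 // => b _.
  by rewrite ffunZE basE LE [_ == a]eq_sym (negPf aL) andbF mulr0.
rewrite addr0 sum_ffunE (bigD1 (tnth L (Defs.next i))) //= big1 => [|b bL]; last first.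
  by rewrite ffunZE basE LE [_ == b]eq_sym (negPf bL) !andbF mulr0.
by rewrite addr0 ffunZE basE LE !eqxx !andbT mulrC.
Qed.

Lemma agree_off_wts J L : agree_off J L ->
  wt (tnth L (pos i)) + wt (tnth L (Defs.next i)) =
    wt (tnth J (pos i)) + wt (tnth J (Defs.next i)) -> wts L = wts J.
Proof.
have wtsE (K : r.-tuple 'I_n.*2) : wts K =
    wt (tnth K (pos i)) + wt (tnth K (Defs.next i)) +
    \sum_(j | (j != pos i) && (j != Defs.next i)) wt (tnth K j).
  rewrite /wts big_tuple (bigD1 (pos i)) //= (bigD1 (Defs.next i)) ?addrA //.
  by rewrite eq_sym pos_neq_next.
move=> /forallP JL eJL; rewrite !wtsE eJL; congr (_ + _).
by apply: eq_bigr => j jN; have /implyP/(_ jN)/eqP-> := JL j.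
Qed.

(** A nonzero entry forces J and L to have the same total weight, hence the same entry of Omega;
    what remains is the symmetry of [op]. *)
Lemma act_at_sym J L : op_sym op -> op_wt op ->
  om q L * act_at op i J L = om q J * act_at op i L J :> kap.
Proof.
move=> ops opw; rewrite !act_atE -ops.
have -> : agree_off L J = agree_off J L.
  by apply: eq_forallb => j; rewrite [tnth J j == _]eq_sym.
have [JL|] := boolP (agree_off J L); last by rewrite !(mul0r, mulr0).
set c := op _ _ _; have [->|c0] := eqVneq (c : kap) 0; first by rewrite !mulr0.
have wJL : wts L = wts J by exact: agree_off_wts JL (esym (opw _ _ _ _ c0)).
by rewrite /om (eq_wt_pairs _ wJL) ?size_tuple.
Qed.

End ActAt.
End LocalOperators.

(** * Diagonal forms and adjoint endomorphisms *)

Lemma transposeD (K : fieldType) (W : vectType K) (f f' : 'End(W)) :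
  transpose (f + f') = transpose f + transpose f'.
Proof. by have := transpose_linear 1 f f'; rewrite !scale1r. Qed.

Lemma transposeZ (K : fieldType) (W : vectType K) a (f : 'End(W)) :
  transpose (a *: f) = a *: transpose f.
Proof.
by apply/lfunP => x; apply/lfunP => y; rewrite !(transposeE, scale_lfunE) linearZ.
Qed.

Section Form.
Variables (kap : fieldType) (I : finType) (w : I -> kap).
Hypothesis w_neq0 : forall i, w i != 0.
Let W : vectType kap := {ffun I -> kap^o}.

Definition diag_form (x y : W) : kap^o := \sum_i w i * x i * y i.

Lemma diag_form_linear x : linear (diag_form x).
Proof.
move=> a y z; rewrite /diag_form scaler_sumr -big_split; apply: eq_bigr => i _ /=.
by rewrite ffunDE ffunZE mulrDr [a *: _]mulrCA.
Qed.

HB.instance Definition _ x :=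
  GRing.isLinear.Build kap W kap^o *:%R (diag_form x) (diag_form_linear x).

Definition diag_dual (x : W) : 'Hom(W, kap^o) := linfun (diag_form x).

Lemma diag_dual_linear : linear diag_dual.
Proof.
move=> a x y; apply/lfunP => z; rewrite !(add_lfunE, scale_lfunE, lfunE) /=.
rewrite /diag_form scaler_sumr -big_split; apply: eq_bigr => i _ /=.
by rewrite ffunDE ffunZE mulrDr mulrDl [a *: _]mulrA mulrCA.
Qed.

HB.instance Definition _ :=
  GRing.isLinear.Build kap W 'Hom(W, kap^o) *:%R diag_dual diag_dual_linear.

Definition diag_iso : 'Hom(W, 'Hom(W, kap^o)) := linfun diag_dual.

Lemma diag_isoE x i : diag_iso x (bas kap i) = w i * x i :> kap.
Proof.
rewrite lfunE /= lfunE /= /diag_form (bigD1 i) //= big1 => [|j ji].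
  by rewrite basE eqxx mulr1 addr0.
by rewrite basE (negPf ji) mulr0.
Qed.

Lemma diag_iso_bij : bijective diag_iso.
Proof.
exists (fun f : 'Hom(W, kap^o) =>
  [ffun i => (w i)^-1 * f (bas kap i) : kap^o] : W) => [x|f].
  by apply/ffunP => i; rewrite ffunE diag_isoE mulKf.
by apply: lfun_basP => i; rewrite diag_isoE ffunE mulVKf.
Qed.

(** That is, (f x, y) = (x, h y) for the diagonal form, written as the intertwining condition that a
    map to the dual module has to satisfy. *)
Definition adjoint (f h : 'End(W)) : Prop :=
  (diag_iso \o f = transpose h \o diag_iso)%VF.

Lemma adjoint_bas (f h : 'End(W)) :
  (forall i j, w j * f (bas kap i) j = w i * h (bas kap j) i :> kap) ->
  adjoint f h.
Proof.
move=> fh; apply: lfun_basP => i; apply: lfun_basP => j.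
rewrite !comp_lfunE transposeE diag_isoE fh.
rewrite lfunE /= lfunE /= /diag_form (bigD1 i) //= big1 => [|l li].
  by rewrite basE eqxx mulr1 addr0.
by rewrite basE (negPf li) mulr0 mul0r.
Qed.

Lemma adjoint1 : adjoint \1 \1.
Proof. by rewrite /adjoint transpose1 comp_lfun1r comp_lfun1l. Qed.

Lemma adjointD f f' h h' : adjoint f h -> adjoint f' h' ->
  adjoint (f + f') (h + h').
Proof.
rewrite /adjoint => fh fh'; rewrite comp_lfunDr fh fh' -comp_lfunDl.
by rewrite transposeD.
Qed.

Lemma adjointZ a f h : adjoint f h -> adjoint (a *: f) (a *: h).
Proof.
by rewrite /adjoint => fh; rewrite -comp_lfunZr fh transposeZ comp_lfunZl.
Qed.

Lemma adjoint_comp f f' h h' : adjoint f h -> adjoint f' h' ->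
  adjoint (f \o f')%VF (h' \o h)%VF.
Proof.
rewrite /adjoint => fh fh'.
by rewrite comp_lfunA fh -comp_lfunA fh' comp_lfunA transpose_comp.
Qed.

(** Serves k_i^-1, whose image under tau is known only as the inverse of tau(k_i). *)
Lemma adjoint_inv f f' h h' : adjoint f h ->
  (f \o f' = \1)%VF -> (h \o h' = \1)%VF -> adjoint f' h'.
Proof.
rewrite /adjoint => fh ff' hh'.
rewrite -[RHS]comp_lfun1r -ff' comp_lfunA -[(_ \o _ \o f)%VF]comp_lfunA fh.
by rewrite comp_lfunA -transpose_comp hh' transpose1 comp_lfun1l.
Qed.

End Form.

(** * Contravariance of Omega and the isomorphism *)

Section Main.
Variables (g : lie_type) (n r : nat) (kap : fieldType) (q : kap).
Hypothesis q_neq0 : q != 0.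
Local Notation Uk := (Uk g n q).
Local Notation B := (BMW r (varrho g n q) q).
Local Notation adj := (adjoint (fun J : r.-tuple 'I_n.*2 => om q J)).
Variable M : bimodule Uk B (Tens n kap r).

(** Taking adjoints and tau both reverse products, so the u with this property form a subalgebra and
    generators suffice. *)
Lemma left_adjoint (tau : algAntiHom Uk Uk) u :
  is_tau tau -> compatible (bleft M) -> adj (bleft M u) (bleft M (tau u)).
Proof.
move=> [_ htau] hM; have tau1 : tau 1 = 1 := anti_one tau.
have Pk i : adj (bleft M (spec q (kA g i))) (bleft M (tau (spec q (kA g i)))).
  have [-> _ _] := htau i; have [kM _ _] := hM i.
  apply: adjoint_bas => J L; rewrite !kM !ffunZE !basE eq_sym.
  by case: (eqVneq J L) => [->|_]; rewrite ?mulr0.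
elim/Uk_ind: u => [i m|i m|i|i||a x Px|x y Px Py|x y Px Py].
- have [_ /(_ m)-> _] := htau i; have [_ _ eM] := hM i.
  by apply: adjoint_bas => J L; exact: eM.
- have [_ _ /(_ m)->] := htau i; have [_ _ eM] := hM i.
  by apply: adjoint_bas => J L; exact/esym/eM.
- exact: Pk.
- apply: (adjoint_inv (Pk i)); rewrite -lact_mul.
    by rewrite spec_kkV lact_one.
  by rewrite -anti_mul spec_kVk tau1 lact_one.
- by rewrite tau1 lact_one; exact: adjoint1.
- by rewrite !linearZ; exact: adjointZ.
- by rewrite !linearD; exact: adjointD.
- by rewrite anti_mul !lact_mul; exact: adjoint_comp.
Qed.

Lemma right_adjoint (sigma : algAntiHom B B) b :
  is_sigma sigma -> is_bmw_action (bright M) ->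
  adj (bright M b) (bright M (sigma b)).
Proof.
move=> [_ hsigma] hM; have sigma1 : sigma 1 = 1 := anti_one sigma.
have adjT i : adj (bright M (bT _ _ i)) (bright M (sigma (bT _ _ i))).
  have [-> _] := hsigma i; apply: adjoint_bas => J L.
  have [-> _] := hM i J; have [-> _] := hM i L.
  by apply: act_at_sym; [exact: Rop_sym|exact: Rop_wt].
have adjE i : adj (bright M (bE _ _ i)) (bright M (sigma (bE _ _ i))).
  have [_ ->] := hsigma i; apply: adjoint_bas => J L.
  have [_ ->] := hM i J; have [_ ->] := hM i L.
  by apply: act_at_sym; [exact: Eop_sym|exact: Eop_wt].
have adj1 : adj (bright M 1) (bright M (sigma 1)).
  by rewrite sigma1 ract_one; exact: adjoint1.
have adjZ a x : adj (bright M x) (bright M (sigma x)) ->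
    adj (bright M (a *: x)) (bright M (sigma (a *: x))).
  by move=> Px; rewrite !linearZ; exact: adjointZ.
have adjD x y : adj (bright M x) (bright M (sigma x)) ->
    adj (bright M y) (bright M (sigma y)) ->
    adj (bright M (x + y)) (bright M (sigma (x + y))).
  by move=> Px Py; rewrite !linearD; exact: adjointD.
elim/palg_ind: b => [[i|i|i]||a x Px|x y Px Py|x y Px Py].
- exact: adjT.
(* [is_sigma] and [is_bmw_action] prescribe values on T_i and E_i only, so T_i^-1 is rewritten in
   terms of these by the skein relation. *)
- have e : gen (A := B) (BTV i) =
      bT _ _ i + (-1) *: ((q - q^-1) *: (1 + (-1) *: bE _ _ i)).
    have := cls_rel (A := B) (bmw_skein _ _ i); rewrite !(clsD, clsZ) => <-.
    by rewrite scalerDr scalerA mulrNN mulr1 scale1r !scaleN1r addNKr.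
  rewrite e; apply: (adjD); first exact: adjT.
  by do 2 apply: (adjZ); apply: (adjD) => //; apply: (adjZ).
- exact: adjE.
- exact: adj1.
- exact: adjZ.
- exact: adjD.
- by rewrite anti_mul !ract_mul; exact: adjoint_comp.
Qed.

End Main.

Theorem corollary3p4
  (g : lie_type) (n r : nat) (hn : (0 < n)%N) (hr : (0 < r)%N)
  (kap : fieldType) (q : kap) (hq0 : q != 0) (hq2 : q ^+ 2 != 1)
  (D : algHom (Uk g n q) (tensor (Uk g n q) (Uk g n q))) (hD : is_comul D)
  (V : lmodule (Uk g n q) (Vec n kap)) (hV : is_natural V)
  (M : bimodule (Uk g n q) (BMW r (varrho g n q) q) (Tens n kap r))
  (hMl : tensor_power D V (bleft M)) (hMr : is_bmw_action (bright M))
  (tau : algAntiHom (Uk g n q) (Uk g n q)) (htau : is_tau tau)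
  (sigma : algAntiHom (BMW r (varrho g n q) q) (BMW r (varrho g n q) q))
  (hsigma : is_sigma sigma) :
  bimodule_iso M (dual_bimodule tau sigma M).
Proof.
have om_neq0 (J : r.-tuple 'I_n.*2) : om q J != 0 by rewrite expfz_neq0.
(* The isomorphism is x |-> Omega(x, -); its entries are powers of q, hence nonzero, and both
   intertwining laws are adjointness evaluated at x. *)
exists (diag_iso (fun J : r.-tuple 'I_n.*2 => om q J)); split.
- exact: diag_iso_bij om_neq0.
- move=> u x; rewrite -!comp_lfunE; congr (fun_of_lfun _ x).
  by apply: left_adjoint => //; exact: tensor_power_compatible hMl.
- move=> b x; rewrite -!comp_lfunE; congr (fun_of_lfun _ x).
  exact: right_adjoint.
Qed.
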